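(* Let $\mathcal H$ be a separable infinite-dimensional Hilbert space, $p\in[1,\infty)$, and let $V\in\mathcal L^{p,\infty}(\mathcal H)$ be strictly positive. Let $(e_l)_{l\in\mathbb N}$ be an orthonormal basis of $\mathcal H$ consisting of eigenvectors of $V$, ordered according to decreasing size of the eigenvalues. If $G\in\mathcal L^{1,\infty}(\mathcal H)$ is weakly $V$-modulated, then for every singular state $\omega$ on $\ell^\infty(\mathbb N)$, $$\operatorname{tr}_\omega(G)=\lim_{N\to\omega}\frac{\sum_{l=0}^N\langle Ge_l,e_l\rangle}{\log(N+2)}.$$
   Context: For $p\in[1,\infty)$, $\mathcal L^{p,\infty}(\mathcal H)$ is the ideal of compact operators whose decreasing singular values satisfy $\mu_k(T)=O((1+k)^{-1/p})$; for $p=1$ the ideal $\mathcal L^{p/(p-1),\infty}(\mathcal H)=\mathcal L^{\infty,\infty}(\mathcal H)$ means the bounded operators $\mathcal B(\mathcal H)$. A bounded operator $V$ is strictly positive if $V\ge0$ and $V\mathcal H$ is dense in $\mathcal H$. For $V\in\mathcal L^{p,\infty}(\mathcal H)$ strictly positive, $G\in\mathcal B(\mathcal H)$ is weakly $V$-modulated if the densely defined operator $GV^{-1}$ extends to a bounded operator belonging to $\mathcal L^{p/(p-1),\infty}(\mathcal H)$. A singular state is a state $\omega$ on $\ell^\infty(\mathbb N)$ vanishing on $c_0(\mathbb N)$; $\lim_{N\to\omega}x_N:=\omega(x)$. The Dixmier trace $\operatorname{tr}_\omega:\mathcal L^{1,\infty}(\mathcal H)\to\mathbb C$ is the linear extension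 of $G\mapsto\lim_{N\to\omega}\frac1{\log N}\sum_{k=0}^N\mu_k(G)$, $G\ge0$. *)

(* Defs.v *)
From HB Require Import structures.
From mathcomp Require Import all_boot all_order all_algebra.
From mathcomp Require Import all_classical all_reals all_analysis.
From mathcomp Require Import complex.

Set Implicit Arguments.
Unset Strict Implicit.
Unset Printing Implicit Defensive.

Import Order.TTheory GRing.Theory Num.Theory.
Import numFieldNormedType.Exports.

Local Open Scope classical_set_scope.
Local Open Scope complex_scope.
Local Open Scope ring_scope.

(* A complex Hilbert space is given by a complete normed module H over R[i]
   and an inner product dot : {dot H for Num.conj} (linear in the first
   argument, conjugate linear in the second) that induces the norm of H. Norms
   on H have values in R[i]; the order of R[i] is such that 0 <= z means that
   z is real and nonnegative. *)

Section HilbertSpace.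
Variables (R : realType) (H : completeNormedModType R[i]).
Variable dot : {dot H for Num.conj}.

Definition dot_induces_norm : Prop := forall x : H, `|x| ^+ 2 = dot x x.

Definition separable_space : Prop :=
  exists D : set H, countable D /\ dense D.

Definition infinite_dimensional : Prop :=
  ~ exists (n : nat) (b : 'I_n -> H),
      forall x : H, exists c : 'I_n -> R[i], x = \sum_(i < n) c i *: b i.

Definition orthonormal_seq (e : nat -> H) : Prop :=
  forall i j : nat, dot (e i) (e j) = (i == j)%:R.

Definition orthonormal_basis (e : nat -> H) : Prop :=
  orthonormal_seq e /\
  forall x : H, (fun n : nat => \sum_(l < n) dot x (e l) *: e l) @ \oo --> x.

Definition bounded_op (T : H -> H) : Prop :=
  linear T /\ exists M : R, forall x : H, `|T x| <= M%:C * `|x|.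

Definition compact_op (T : H -> H) : Prop :=
  linear T /\ precompact (T @` [set x | `|x| <= 1]).

Definition positive_op (T : H -> H) : Prop :=
  bounded_op T /\ forall x : H, 0 <= dot (T x) x.

Definition strictly_positive_op (T : H -> H) : Prop :=
  positive_op T /\ dense (range T).

Definition is_adjoint (T Tad : H -> H) : Prop :=
  bounded_op Tad /\ forall x y : H, dot (T x) y = dot x (Tad y).

(* mu lists, in decreasing order and with multiplicity, the square roots of the
   eigenvalues of T^* T, i.e. the eigenvalues of |T|: the f k are orthonormal
   eigenvectors and T^* T vanishes on their orthogonal complement, so no nonzero
   eigenvalue is missed. If T has finite rank, the list is padded with zeros.
   For a compact T on an infinite-dimensional H such a mu exists and is unique. *)
Definition is_singular_values (T : H -> H) (mu : nat -> R) : Prop :=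
  [/\ nonincreasing_seq mu,
      forall k : nat, 0 <= mu k &
      exists (Tad : H -> H) (f : nat -> H),
        [/\ is_adjoint T Tad,
            orthonormal_seq f,
            forall k : nat, Tad (T (f k)) = (mu k ^+ 2)%:C *: f k &
            forall x : H, (forall k : nat, dot x (f k) = 0) -> Tad (T x) = 0]].

Definition singular_values (T : H -> H) : nat -> R :=
  xget (fun=> 0) [set mu | is_singular_values T mu].

(* The ideal L^{p,oo}(H), for 1 <= p < oo. *)
Definition weak_schatten (p : R) (T : H -> H) : Prop :=
  compact_op T /\
  exists C : R, forall k : nat,
    singular_values T k <= C * (1 + k%:R) `^ (- p^-1).

(* The ideal L^{p/(p-1),oo}(H), which for p = 1 is B(H). *)
Definition weak_schatten_dual (p : R) (T : H -> H) : Prop :=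
  if p == 1 then bounded_op T else weak_schatten (p / (p - 1)) T.

(* The domain of G V^{-1} is the range of V, so that B extends G V^{-1} exactly
   when B (V y) = G y for all y. *)
Definition weakly_modulated (p : R) (V G : H -> H) : Prop :=
  bounded_op G /\
  exists B : H -> H,
    [/\ bounded_op B, weak_schatten_dual p B & forall y : H, B (V y) = G y].

Definition ell_infty (x : nat -> R[i]) : Prop :=
  exists M : R, forall n : nat, `|x n| <= M%:C.

Definition c_zero (x : nat -> R[i]) : Prop :=
  (x : nat -> R[i]^o) @ \oo --> (0 : R[i]^o).

(* Only the values of omega on ell_infty are constrained. *)
Definition singular_state (omega : (nat -> R[i]) -> R[i]) : Prop :=
  [/\ forall (a : R[i]) (x y : nat -> R[i]), ell_infty x -> ell_infty y ->
        omega (fun n => a * x n + y n) = a * omega x + omega y,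
      forall x : nat -> R[i], ell_infty x -> (forall n, 0 <= x n) ->
        0 <= omega x,
      omega (fun=> 1) = 1 &
      forall x : nat -> R[i], c_zero x -> omega x = 0].

(* The quotient is 0 for N = 0 and N = 1, where ln N = 0; this is immaterial
   since singular states vanish on c_0. *)
Definition is_dixmier_trace (omega : (nat -> R[i]) -> R[i])
    (tr : (H -> H) -> R[i]) : Prop :=
  (forall (a : R[i]) (S T : H -> H), weak_schatten 1 S -> weak_schatten 1 T ->
     tr (fun x => a *: S x + T x) = a * tr S + tr T) /\
  (forall G : H -> H, weak_schatten 1 G -> positive_op G ->
     tr G = omega (fun N : nat =>
              ((\sum_(k < N.+1) singular_values G k) / ln N%:R)%:C)).

(* Since L^{1,oo}(H) is spanned by its positive elements, is_dixmier_trace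
   determines the values on L^{1,oo}(H); those elsewhere are irrelevant. *)
Definition dixmier_trace (omega : (nat -> R[i]) -> R[i]) : (H -> H) -> R[i] :=
  xget (fun=> 0) [set tr | is_dixmier_trace omega tr].

End HilbertSpace.

Arguments infinite_dimensional {R} H.
Arguments separable_space {R} H.

(* Main.v *)
Require Import Defs.
From HB Require Import structures.
From mathcomp Require Import all_boot all_order all_algebra.
From mathcomp Require Import all_classical all_reals all_analysis.
From mathcomp Require Import complex.
From mathcomp Require Import ring lra.

Set Implicit Arguments.
Unset Strict Implicit.
Unset Printing Implicit Defensive.

Import Order.TTheory GRing.Theory Num.Theory.
Import numFieldNormedType.Exports.

Local Open Scope classical_set_scope.
Local Open Scope complex_scope.
Local Open Scope ring_scope.

(* Call finite orthonormal systems [u N] of size O(N) adapted to an operator [X]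
   if [X] has norm O(1/N) on the orthogonal complement of [u N]. The traces of [X]
   over two adapted families differ by O(1): complete both to bases of the same
   span; the added vectors are O(N) in number and each contributes O(1/N). Hence
   [omega] of the traces divided by log N depends only on [X], and it is linear in
   [X] because two families have a common refinement. Singular vectors are adapted
   to an operator of weak trace class, so this functional is the Dixmier trace on
   positive operators, and everywhere since these span L^{1,oo}.

   The eigenvectors [e l] of [V] need not be adapted to [G = B V] when [p > 1], but
   comparing them with the singular vectors of [G] leaves only the trace of [B V]
   over at most N + 1 vectors orthogonal to [e 0, .., e N]. There [V] has norm
   O(N^{-1/p}); the first N + 1 singular vectors of [B] contribute at most
   O(N^{-1/p}) times the sum of the singular values, which is O(N^{1/p}), and
   the others at most N O(N^{-1/p}) O(N^{1/p - 1}) = O(1). *)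

(** [dixmier_trace] is picked by [xget] among the functionals satisfying [is_dixmier_trace], so such
    a functional must be shown to exist and to be unique on L^{1,oo}. The obstacle to existence is
    that sums of singular values are not additive in the operator, whereas the trace over a fixed
    finite system is linear. The price is dependence on the system; size O(N) against norm O(1/N) is
    the balance that keeps this dependence bounded, hence invisible after division by log N. The
    same device replaces inequalities for singular values of sums and products: a compact operator
    with an adapted family is of weak trace class. Uniqueness requires positive operators that span
    and stay inside the ideal; they come from the polar decomposition by polarisation, without
    square roots or spectral projections. *)

Definition rnorm (R : realType) (U : normedZmodType R[i]) (x : U) : R :=
  complex.Re `|x|.

(** * Real-valued norms, in place of norms with values in [R[i]] *)

Section RealNorm.
Variables (R : realType).
Implicit Types (U : normedZmodType R[i]).

Lemma rnormE U (x : U) : `|x| = (rnorm x)%:C.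
Proof. by rewrite /rnorm RRe_real// ger0_real. Qed.

Lemma rnorm_ge0 U (x : U) : 0 <= rnorm x.
Proof. by rewrite -ler0c -rnormE. Qed.

Lemma rnorm0 U : rnorm (0 : U) = 0.
Proof. by rewrite /rnorm normr0. Qed.

Lemma rnorm_eq0 U (x : U) : rnorm x = 0 -> x = 0.
Proof. by move=> h; apply/eqP; rewrite -normr_eq0 rnormE h. Qed.

Lemma rnormD U (x y : U) : rnorm (x + y) <= rnorm x + rnorm y.
Proof. by rewrite -lecR rmorphD/= -!rnormE ler_normD. Qed.

Lemma rnormN U (x : U) : rnorm (- x) = rnorm x.
Proof. by rewrite /rnorm normrN. Qed.

Lemma rnormB U (x y : U) : rnorm (x - y) <= rnorm x + rnorm y.
Proof. by rewrite -(rnormN y) rnormD. Qed.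

Lemma rdistC U (x y : U) : rnorm (x - y) = rnorm (y - x).
Proof. by rewrite -rnormN opprB. Qed.

Lemma rnorm_sum U (I : Type) (r : seq I) (F : I -> U) :
  rnorm (\sum_(i <- r) F i) <= \sum_(i <- r) rnorm (F i).
Proof.
elim/big_rec2: _ => [|i y x _ h]; first by rewrite rnorm0.
by apply: le_trans (rnormD _ _) _; rewrite lerD2l.
Qed.

Lemma rnormM (a b : R[i]) : rnorm (a * b) = rnorm a * rnorm b.
Proof. by apply: complexI; rewrite rmorphM/= -!rnormE normrM. Qed.

Lemma rnorm_real (a : R) : rnorm (a%:C : R[i]) = `|a|.
Proof.
rewrite /rnorm normc_def /= expr0n /= addr0 sqrtr_sqr //.
Qed.

Lemma conjC_real (a : R) : Num.conj (a%:C : R[i]) = a%:C.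
Proof. by apply/CrealP/complex_realP; exists a. Qed.

Lemma mul_conjE (a : R[i]) : a * Num.conj a = (rnorm a ^+ 2)%:C.
Proof. by rewrite -normCK rnormE rmorphXn. Qed.

Lemma rnormZ (H : normedModType R[i]) (a : R[i]) (x : H) :
  rnorm (a *: x) = rnorm a * rnorm x.
Proof. by apply: complexI; rewrite rmorphM/= -!rnormE normrZ. Qed.

End RealNorm.

Section InnerProduct.
Variables (R : realType) (H : completeNormedModType R[i]).
Variable dot : {dot H for Num.conj}.
Hypothesis dot_norm : dot_induces_norm dot.
Implicit Types (x y z : H) (a b : R[i]).

Lemma dotxx x : dot x x = (rnorm x ^+ 2)%:C.
Proof. by rewrite -dot_norm rnormE rmorphXn. Qed.

Lemma dotC x y : dot y x = Num.conj (dot x y).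
Proof. by rewrite (hermC dot) expr0 mul1r. Qed.

Lemma dotZl a x y : dot (a *: x) y = a * dot x y.
Proof. exact: linearZl_LR. Qed.

Lemma dotZr a x y : dot x (a *: y) = Num.conj a * dot x y.
Proof. exact: linearZr_LR. Qed.

Lemma dotDl x y z : dot (x + y) z = dot x z + dot y z.
Proof. exact: linearDl. Qed.

Lemma dotDr x y z : dot x (y + z) = dot x y + dot x z.
Proof. exact: linearDr. Qed.

Lemma dotBl x y z : dot (x - y) z = dot x z - dot y z.
Proof. exact: linearBl. Qed.

Lemma dotBr x y z : dot x (y - z) = dot x y - dot x z.
Proof. exact: linearBr. Qed.

Lemma dot0l x : dot 0 x = 0.
Proof. exact: linear0l. Qed.

Lemma dot0r x : dot x 0 = 0.
Proof. exact: linear0r. Qed.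

Lemma dot_suml (I : Type) (r : seq I) (F : I -> H) x :
  dot (\sum_(i <- r) F i) x = \sum_(i <- r) dot (F i) x.
Proof. by elim/big_rec2: _ => [|i y1 y2 _ <-]; rewrite (dot0l, dotDl). Qed.

Lemma dot_sumr (I : Type) (r : seq I) (F : I -> H) x :
  dot x (\sum_(i <- r) F i) = \sum_(i <- r) dot x (F i).
Proof. by elim/big_rec2: _ => [|i y1 y2 _ <-]; rewrite (dot0r, dotDr). Qed.

Lemma dot_eq0C x y : dot x y = 0 -> dot y x = 0.
Proof. by move=> h; rewrite dotC h conjC0. Qed.

Lemma rnorm_sqrD x y : dot x y = 0 ->
  rnorm (x + y) ^+ 2 = rnorm x ^+ 2 + rnorm y ^+ 2.
Proof.
move=> h; apply: complexI; rewrite rmorphD/= -!dotxx.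
by rewrite dotDl !dotDr h (dot_eq0C h) addr0 add0r.
Qed.

Lemma rnorm_sqrB x y : dot x y = 0 ->
  rnorm (x - y) ^+ 2 = rnorm x ^+ 2 + rnorm y ^+ 2.
Proof.
by move=> h; rewrite rnorm_sqrD ?rnormN// -scaleN1r dotZr h mulr0.
Qed.

Lemma rnorm_sqrB_real x y (r : R) : dot x y = r%:C ->
  rnorm (x - y) ^+ 2 = rnorm x ^+ 2 + rnorm y ^+ 2 - 2 * r.
Proof.
move=> h; apply: complexI.
rewrite rmorphB rmorphD/= -!dotxx dotBl !dotBr (dotC x y) h.
rewrite conjC_real rmorphM/= rmorph_nat mulr_natl mulr2n !opprB !opprD !addrA.
by congr (_ - _); rewrite addrAC.
Qed.

(** Cauchy-Schwarz: [c *: y] is the projection of [x] on the line of [y], and by Pythagoras it is no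
    longer than [x]. *)
Lemma dot_le x y : rnorm (dot x y) <= rnorm x * rnorm y.
Proof.
have [y0|y0] := eqVneq y 0.
  by rewrite y0 dot0r !rnorm0 mulr0.
have ny : 0 < rnorm y.
  by rewrite lt_neqAle rnorm_ge0 andbT eq_sym; apply: contra_neq y0 => /rnorm_eq0.
pose c := dot x y / (rnorm y ^+ 2)%:C.
have y2 : (rnorm y ^+ 2)%:C != 0 :> R[i].
  by rewrite (_ : 0 = (0:R)%:C)// (inj_eq (@complexI _)) expf_neq0// gt_eqF.
have o : dot (x - c *: y) (c *: y) = 0.
  by rewrite dotZr dotBl dotZl dotxx /c mulfVK// subrr mulr0.
have := rnorm_sqrD o; rewrite subrK rnormZ /c rnormM => e.
have : (rnorm (dot x y) * rnorm ((rnorm y ^+ 2)%:C^-1 : R[i]) * rnorm y) ^+ 2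
   <= rnorm x ^+ 2 by rewrite e lerDr sqr_ge0.
rewrite ler_pXn2r// ?nnegrE ?mulr_ge0 ?rnorm_ge0//.
rewrite -fmorphV rnorm_real ger0_norm ?invr_ge0 ?sqr_ge0//.
by rewrite expr2 invfM -mulrA mulfVK ?gt_eqF// ler_pdivrMr.
Qed.

End InnerProduct.

(** * Finite orthonormal systems *)

Section OrthonormalLists.
Variables (R : realType) (H : completeNormedModType R[i]).
Variable dot : {dot H for Num.conj}.
Hypothesis dot_norm : dot_induces_norm dot.
Implicit Types (x y z : H) (a b : R[i]) (u v w : seq H) (T : H -> H).

Lemma linearf0 T : linear T -> T 0 = 0.
Proof. by move=> l; have := l (-1) 0 0; rewrite scaler0 addr0 scaleN1r addNr. Qed.

Lemma linearfD T : linear T -> forall x y, T (x + y) = T x + T y.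
Proof. by move=> l x y; have := l 1 x y; rewrite !scale1r. Qed.

Lemma linearfZ T : linear T -> forall a x, T (a *: x) = a *: T x.
Proof. by move=> l a x; have := l a x 0; rewrite (linearf0 l) !addr0. Qed.

Lemma linearfB T : linear T -> forall x y, T (x - y) = T x - T y.
Proof.
by move=> l x y; rewrite (linearfD l) -scaleN1r (linearfZ l) scaleN1r.
Qed.

Lemma linearf_sum T : linear T -> forall (I : Type) (r : seq I) (F : I -> H),
  T (\sum_(i <- r) F i) = \sum_(i <- r) T (F i).
Proof.
move=> l I r F; elim/big_rec2: _ => [|i y1 y2 _ <-]; first exact: linearf0.
by rewrite (linearfD l).
Qed.

(** The second clause compares vectors and not positions, so repetitions have to be excluded
    separately. *)
Definition orthonormal_list u :=
  uniq u /\ {in u &, forall x y, dot x y = (x == y)%:R}.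

Definition perp x u := forall y, y \in u -> dot x y = 0.

Definition proj u x := \sum_(y <- u) dot x y *: y.

Definition trace_on T u := \sum_(y <- u) dot (T y) y.

Lemma orthonormal_list_nil : orthonormal_list [::]. Proof. by split. Qed.

Lemma orthonormal_list_dot_sum u (c : H -> R[i]) y : orthonormal_list u -> y \in u ->
  dot (\sum_(z <- u) c z *: z) y = c y.
Proof.
move=> [uu ou] yu; rewrite dot_suml (bigD1_seq y)//= dotZl ou// eqxx mulr1.
rewrite big_seq_cond big1 ?addr0// => z /andP[zu zy].
by rewrite dotZl ou// (negbTE zy) mulr0.
Qed.

Lemma perp_proj u x : orthonormal_list u -> perp (x - proj u x) u.
Proof. by move=> ou y yu; rewrite dotBl /proj orthonormal_list_dot_sum// subrr. Qed.

Lemma rnorm_comb u (c : H -> R[i]) : orthonormal_list u ->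
  rnorm (\sum_(y <- u) c y *: y) ^+ 2 = \sum_(y <- u) rnorm (c y) ^+ 2.
Proof.
move=> ou; apply: complexI; rewrite -(dotxx dot_norm) dot_sumr rmorph_sum/=.
apply: eq_big_seq => y yu.
by rewrite dotZr orthonormal_list_dot_sum// mulrC mul_conjE.
Qed.

Lemma perp_dot_comb u (c : H -> R[i]) x : perp x u ->
  dot x (\sum_(y <- u) c y *: y) = 0.
Proof.
move=> h; rewrite dot_sumr big_seq big1// => y yu.
by rewrite dotZr h// mulr0.
Qed.

Lemma proj_pythagoras u x : orthonormal_list u ->
  rnorm x ^+ 2 = rnorm (x - proj u x) ^+ 2 + rnorm (proj u x) ^+ 2.
Proof.
move=> ou; rewrite -(rnorm_sqrD dot_norm) ?subrK//.
exact: perp_dot_comb (perp_proj _ ou).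
Qed.

Lemma rnorm_proj_le u x : orthonormal_list u -> rnorm (proj u x) <= rnorm x.
Proof.
move=> ou; rewrite -(@ler_pXn2r _ 2)// ?nnegrE ?rnorm_ge0//.
by rewrite (proj_pythagoras x ou) lerDr sqr_ge0.
Qed.

Lemma bessel u x : orthonormal_list u ->
  \sum_(y <- u) rnorm (dot x y) ^+ 2 <= rnorm x ^+ 2.
Proof.
move=> ou; rewrite -(rnorm_comb (dot x) ou).
by rewrite ler_pXn2r ?nnegrE ?rnorm_ge0// rnorm_proj_le.
Qed.

Lemma orthonormal_list_norm u y : orthonormal_list u -> y \in u -> rnorm y = 1.
Proof.
move=> [_ ou] yu; have := ou _ _ yu yu; rewrite eqxx (dotxx dot_norm).
move=> /(@complexI _ _ 1) /eqP; rewrite sqrp_eq1 ?rnorm_ge0// => /eqP //.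
Qed.

Lemma normalized x : x <> 0 ->
  rnorm ((rnorm x)^-1%:C *: x) = 1.
Proof.
move=> x0; have nx : rnorm x != 0 by apply/eqP => /rnorm_eq0.
by rewrite rnormZ rnorm_real ger0_norm ?invr_ge0 ?rnorm_ge0// mulVf.
Qed.

Lemma orthonormal_list_rcons u y : orthonormal_list u -> perp y u -> rnorm y = 1 ->
  orthonormal_list (rcons u y).
Proof.
move=> [uu ou] py ny.
have yy : dot y y = 1 by rewrite (dotxx dot_norm) ny expr1n.
have yu : y \notin u.
  apply/negP => /py; rewrite yy => /eqP; by rewrite oner_eq0.
split; first by rewrite rcons_uniq yu uu.
move=> s t; rewrite !mem_rcons !inE => /orP[/eqP->|su] /orP[/eqP->|tu].
- by rewrite eqxx.
- by rewrite py//; case: eqP => // e; rewrite -e (negPf yu) in tu.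
- rewrite (dot_eq0C (py _ su)).
  by case: eqP => // e; rewrite -e su in yu.
- exact: ou.
Qed.

Lemma orthonormal_list_catr u v : orthonormal_list (u ++ v) -> orthonormal_list v.
Proof.
move=> [uu ou]; split; first by move: uu; rewrite cat_uniq => /and3P[].
by move=> x y xu yu; rewrite ou// mem_cat (xu, yu) orbT.
Qed.

Lemma orthonormal_list_cat_perp u v y : orthonormal_list (u ++ v) -> y \in v -> perp y u.
Proof.
move=> [+ ou] yv z zu; rewrite ou ?mem_cat ?yv ?zu ?orbT//.
rewrite cat_uniq => /and3P[_ /hasPn/(_ _ yv) h _].
by case: eqP => // e; rewrite /= e zu in h.
Qed.

(** Spans are recorded through their orthogonal complements: the last clause says that [u ++ v]
    spans the same space as [u] and [w] together. *)
Lemma gram_schmidt u w : orthonormal_list u -> exists v,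
  [/\ orthonormal_list (u ++ v), (size v <= size w)%N &
      forall x, perp x (u ++ v) <-> perp x u /\ perp x w].
Proof.
elim/last_ind: w => [|w y IH] ou.
  by exists [::]; rewrite cats0; split=> // x; split=> [|[]//]; split.
have [v [ov sv pv]] := IH ou.
pose z := y - proj (u ++ v) y.
have pz := perp_proj y ov; rewrite -/z in pz.
have yE : y = z + proj (u ++ v) y by rewrite subrK.
have perpy x : perp x (u ++ v) -> dot x y = dot x z.
  by move=> px; rewrite {1}yE dotDr (perp_dot_comb _ px) addr0.
(* If [y] already lies in the span, nothing is added; hence [v] may be shorter than [w]. *)
have [z0|/eqP z0] := eqVneq z 0.
  exists v; split=> //; first by rewrite size_rcons leqW.
  move=> x; split=> [px|[pu pw]].
    have [pu pw] := (pv x).1 px; split=> // t; rewrite mem_rcons inE.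
    by move=> /orP[/eqP->|/pw//]; rewrite perpy// z0 dot0r.
  by apply/pv; split=> // t tw; apply: pw; rewrite mem_rcons inE tw orbT.
have nz0 : (rnorm z)^-1%:C != 0 :> R[i].
  rewrite (_ : 0 = (0:R)%:C)// (inj_eq (@complexI _)) invr_eq0.
  by apply/eqP => /rnorm_eq0.
exists (rcons v ((rnorm z)^-1%:C *: z)); split; rewrite -?rcons_cat.
- apply: orthonormal_list_rcons => //; last exact: normalized.
  by move=> t /pz tz; rewrite dotZl tz mulr0.
- by rewrite !size_rcons ltnS.
- have dz x : dot x ((rnorm z)^-1%:C *: z) = 0 <-> dot x z = 0.
    rewrite dotZr; split=> [/eqP|->]; last by rewrite mulr0.
    by rewrite mulf_eq0 conjC_eq0 (negbTE nz0)/= => /eqP.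
  move=> x; split=> [px|[pu pw]].
    have px' : perp x (u ++ v).
      by move=> t tt; apply: px; rewrite mem_rcons inE tt orbT.
    have [pu pw] := (pv x).1 px'; split=> // t; rewrite mem_rcons inE.
    move=> /orP[/eqP->|/pw//]; rewrite perpy//; apply/dz; apply: px.
    by rewrite mem_rcons inE eqxx.
  have px' : perp x (u ++ v).
    by apply/pv; split=> // t tw; apply: pw; rewrite mem_rcons inE tw orbT.
  move=> t; rewrite mem_rcons inE => /orP[/eqP->|/px'//]; apply/dz.
  by rewrite -perpy//; apply: pw; rewrite mem_rcons inE eqxx.
Qed.

(** The difference of [y] and its projection is orthogonal to [u], hence to both of its terms and so
    to itself. *)
Lemma proj_id u y : orthonormal_list u -> (forall x, perp x u -> dot x y = 0) ->
  y = proj u y.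
Proof.
move=> ou h; apply/eqP; rewrite -subr_eq0; apply/eqP; apply: rnorm_eq0.
have py := perp_proj y ou.
apply/eqP; rewrite -sqrf_eq0; apply/eqP; apply: complexI.
by rewrite -(dotxx dot_norm) {1}dotBr h// (perp_dot_comb _ py) subrr.
Qed.

(** By [proj_id] each system expands in the other, and both traces become the same double sum over
    [u] and [v]. *)
Lemma trace_on_span T u v : linear T -> orthonormal_list u -> orthonormal_list v ->
  (forall x, perp x u <-> perp x v) -> trace_on T u = trace_on T v.
Proof.
move=> lT ou ov uv.
have uE y : y \in u -> y = proj v y.
  by move=> yu; apply: proj_id => // x /uv; exact.
have vE y : y \in v -> y = proj u y.
  by move=> yv; apply: proj_id => // x /uv; exact.
rewrite /trace_on.
transitivity (\sum_(y <- u) \sum_(z <- v) dot z y * dot (T y) z).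
  apply: eq_big_seq => y yu; rewrite [X in dot _ X](uE _ yu) dot_sumr.
  by apply: eq_bigr => z _; rewrite dotZr -dotC.
rewrite exchange_big/=; apply: eq_big_seq => z zv.
rewrite [X in T X](vE _ zv) (linearf_sum lT) dot_suml.
by apply: eq_bigr => y _; rewrite (linearfZ lT) dotZl.
Qed.

Lemma trace_on_cat T u v : trace_on T (u ++ v) = trace_on T u + trace_on T v.
Proof. exact: big_cat. Qed.

Lemma trace_on_le T u (d : R) : orthonormal_list u ->
  (forall y, y \in u -> rnorm (T y) <= d) ->
  rnorm (trace_on T u) <= (size u)%:R * d.
Proof.
move=> ou h; apply: le_trans (rnorm_sum _ _) _.
rewrite mulr_natl -iter_addr_0 -[size u]count_predT -big_const_seq.
rewrite big_seq [leRHS]big_seq; apply: ler_sum => y yu.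
apply: le_trans (dot_le dot_norm _ _) _.
by rewrite (orthonormal_list_norm ou yu) mulr1 h.
Qed.

Lemma orthonormal_mkseq (e : nat -> H) n : orthonormal_seq dot e ->
  orthonormal_list (mkseq e n).
Proof.
move=> oe; have ie : injective e.
  move=> i j ij; have := oe i j; rewrite ij oe eqxx.
  by case: eqP => // _ /eqP; rewrite oner_eq0.
split; first exact: mkseq_uniq.
move=> x y /mapP[i _ ->] /mapP[j _ ->]; rewrite oe (inj_eq ie)//.
Qed.

Lemma orthonormal_seq_mkseq (f : nat -> H) :
  (forall n, orthonormal_list (mkseq f n)) -> orthonormal_seq dot f.
Proof.
move=> h i j; have [] := h (maxn i j).+1.
move=> /mkseq_uniqP inj ou; rewrite ou.
- congr (nat_of_bool _)%:R; apply/eqP/eqP => [|->//].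
  by apply: inj; rewrite inE ltnS ?leq_maxl ?leq_maxr.
- by apply/mapP; exists i => //; rewrite mem_iota add0n ltnS leq_maxl.
- by apply/mapP; exists j => //; rewrite mem_iota add0n ltnS leq_maxr.
Qed.

(** At most [k] linear equations in [k.+1] unknowns. As [dot] is linear in its first argument, a
    solution is a row in the left kernel of [A]; entries beyond the end of [w] are read as 0 and
    give trivial equations. *)
Lemma perp_combination (e : nat -> H) w k : orthonormal_seq dot e ->
  (size w <= k)%N ->
  exists c : nat -> R[i],
    let x := \sum_(i < k.+1) c i *: e i in x <> 0 /\ perp x w.
Proof.
move=> oe wk.
pose A : 'M[R[i]]_(k.+1, k) := \matrix_(i, j) dot (e i) w`_j.
have : kermx A != 0.
  rewrite kermx_eq0 /row_free; apply/eqP => h.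
  by have := rank_leq_col A; rewrite h ltnn.
move=> /rowV0Pn[r /sub_kermxP rA r0].
pose c n := if insub n is Some i then r 0 i else 0.
have cE (i : 'I_k.+1) : c i = r 0 i by rewrite /c valK.
exists c => x; split.
  move=> x0; move/negP: r0; apply; apply/eqP/rowP => j; rewrite mxE -cE.
  have : dot x (e j) = c j.
    rewrite dot_suml (bigD1 j)//= dotZl oe eqxx mulr1 big1 ?addr0// => i ij.
    rewrite dotZl oe; case: eqP => [/val_inj e0|]; last by rewrite mulr0.
    by rewrite e0 eqxx in ij.
  by rewrite x0 dot0l => <-.
move=> y /(nthP 0)[j js <-].
have jk := leq_trans js wk.
move/rowP: rA => /(_ (Ordinal jk)); rewrite !mxE => rA.
rewrite dot_suml -[RHS]rA; apply: eq_bigr => i _.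
by rewrite mxE dotZl cE.
Qed.

(** An infinite orthonormal sequence ensures that no finite list exhausts the space. *)
Lemma orthogonal_unit (e : nat -> H) w : orthonormal_seq dot e ->
  exists x, rnorm x = 1 /\ perp x w.
Proof.
move=> oe; have [c /=[x0 px]] := perp_combination oe (leqnn (size w)).
set x := \sum_(i < _) _ in x0 px.
exists ((rnorm x)^-1%:C *: x); split; first exact: normalized.
by move=> y yw; rewrite dotZl px// mulr0.
Qed.

End OrthonormalLists.

(** * Convergence and adjoints *)

Section Convergence.
Variables (R : realType).
Implicit Types (U : normedZmodType R[i]).

(** A real tolerance serves [H] and [R[i]] alike; [cvg_converges] and [cauchy_converges] make the
    link with filters and completeness. *)
Definition converges U (u : nat -> U) (x : U) : Prop :=
  forall eps : R, 0 < eps ->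
    exists N : nat, forall n, (N <= n)%N -> rnorm (u n - x) < eps.

Lemma converges_unique U (u : nat -> U) x y :
  converges u x -> converges u y -> x = y.
Proof.
move=> ux uy; apply/eqP; rewrite -subr_eq0; apply/eqP; apply: rnorm_eq0.
apply/eqP; rewrite eq_le rnorm_ge0 andbT; apply/ler_addgt0Pr => e e0.
have e2 : 0 < e / 2 by rewrite divr_gt0.
have [N hN] := ux _ e2; have [M hM] := uy _ e2; pose n := maxn N M.
rewrite add0r (_ : x - y = (x - u n) + (u n - y)); last by rewrite addrA subrK.
apply: le_trans (rnormD _ _) _; rewrite rdistC.
by have := hN n (leq_maxl _ _); have := hM n (leq_maxr _ _); lra.
Qed.

Lemma converges_const U (x : U) : converges (fun=> x) x.
Proof. by move=> e e0; exists 0%N => n _; rewrite subrr rnorm0. Qed.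

Lemma eq_converges U (u v : nat -> U) x :
  u =1 v -> converges u x -> converges v x.
Proof. by move=> /funext ->. Qed.

Lemma converges_le U (u : nat -> U) x (M : R) (n0 : nat) :
  converges u x -> (forall n, (n0 <= n)%N -> rnorm (u n) <= M) -> rnorm x <= M.
Proof.
move=> ux h; apply/ler_addgt0Pr => e e0.
have [N hN] := ux _ e0; pose n := maxn n0 N.
have := hN n (leq_maxr _ _); have := h n (leq_maxl _ _).
have := rnormD (x - u n) (u n); rewrite subrK rdistC; lra.
Qed.

Lemma converges_map U U' (T : U -> U') (M : R) (u : nat -> U) x :
  (forall y z, rnorm (T y - T z) <= M * rnorm (y - z)) ->
  converges u x -> converges (T \o u) (T x).
Proof.
move=> h ux e e0; have M0 : 0 < `|M| + 1 by rewrite ltr_pwDr.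
have [N hN] := ux (e / (`|M| + 1)) (divr_gt0 e0 M0).
exists N => n /hN; rewrite ltr_pdivlMr// => le.
apply: le_lt_trans (h _ _) _; apply: le_lt_trans le.
rewrite mulrC ler_wpM2l ?rnorm_ge0//.
by apply: le_trans (ler_norm _) _; rewrite lerDl.
Qed.

(** Nonnegativity in [R[i]] means a vanishing imaginary part and a nonnegative real part; both are
    closed conditions, as either part is bounded by the norm. *)
Lemma converges_ge0 (u : nat -> R[i]) (x : R[i]) :
  converges u x -> (forall n, 0 <= u n) -> 0 <= x.
Proof.
move=> ux h; rewrite lecE/=.
have key (z : R[i]) : `|complex.Re z| <= rnorm z.
  by rewrite -lecR -rnormE; exact: normc_ge_Re.
have keyI (z : R[i]) : `|complex.Im z| <= rnorm z.
  rewrite (_ : complex.Im z = - complex.Re (z * 'i)); last first.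
    by case: z => a b /=; rewrite mulr0 mulr1 sub0r opprK.
  rewrite normrN; apply: le_trans (key _) _.
  by rewrite rnormM {2}/rnorm normc_def/= expr0n expr1n add0r sqrtr1 mulr1.
have hRe n : 0 <= complex.Re (u n) by have := h n; rewrite lecE => /andP[].
have hIm n : complex.Im (u n) = 0 by have := h n; rewrite lecE => /andP[/eqP].
have dRe n : complex.Re (u n - x) = complex.Re (u n) - complex.Re x.
  by case: (u n) (x) => ? ? [].
have dIm n : complex.Im (u n - x) = - complex.Im x.
  by rewrite -[RHS]add0r -(hIm n); case: (u n) (x) => ? ? [].
apply/andP; split.
  rewrite -normr_eq0 eq_le normr_ge0 andbT; apply/ler_addgt0Pr => e /ux[N hN].
  have := hN N (leqnn _); have := keyI (u N - x).
  by rewrite dIm normrN; lra.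
apply/ler_addgt0Pr => e /ux[N hN].
have := hN N (leqnn _); have := key (u N - x); rewrite dRe.
have := hRe N; have := ler_norm (complex.Re (u N) - complex.Re x); lra.
Qed.

Lemma tail_converges U (s t : nat -> U) (x : U) n0 :
  (forall n, (n0 <= n)%N -> s n = t n) -> converges s x -> converges t x.
Proof.
move=> st sx e /sx[N hN]; exists (maxn n0 N) => n; rewrite geq_max => /andP[h1 h2].
by rewrite -st// hN.
Qed.

Lemma converges_sqr_rate U (s : nat -> U) (x : U) (C : R) :
  (forall n, rnorm (s n - x) ^+ 2 <= C / n.+1%:R) -> converges s x.
Proof.
move=> h e e0; have e2 : 0 < e ^+ 2 by rewrite exprn_gt0.
exists (Num.truncn (C / e ^+ 2)).+1 => n Nn.
rewrite -(@ltr_pXn2r _ 2)// ?nnegrE ?rnorm_ge0 ?(ltW e0)//.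
apply: le_lt_trans (h n) _; rewrite ltr_pdivrMr// mulrC -ltr_pdivrMr//.
apply: lt_trans (truncnS_gt _) _; rewrite ltr_nat; exact: leq_ltn_trans Nn _.
Qed.

Lemma converges_norm U (s : nat -> U) (x : U) (c : R) :
  converges s x -> (forall n, rnorm (s n) = c) -> rnorm x = c.
Proof.
move=> sx h; apply/eqP; rewrite eq_le; apply/andP; split.
  by apply: (converges_le (n0 := 0) sx) => n _; rewrite h.
apply/ler_addgt0Pr => e /sx[N /(_ _ (leqnn _)) h1].
by have := rnormD (s N - x) x; rewrite subrK h; lra.
Qed.

End Convergence.

Section Operators.
Variables (R : realType) (H : completeNormedModType R[i]).
Variable dot : {dot H for Num.conj}.
Hypothesis dot_norm : dot_induces_norm dot.
Implicit Types (x y z : H) (a b : R[i]) (S T : H -> H).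

Lemma cvg_converges (s : nat -> H) x : s @ \oo --> x -> converges s x.
Proof.
move=> /cvgrPdist_lt sx e e0.
have e0' : 0 < e%:C :> R[i] by rewrite (ltcR 0).
have [N _ hN] := sx _ e0'; exists N => n Nn.
by rewrite rdistC -ltcR -rnormE; exact: hN.
Qed.

Lemma cauchy_converges (s : nat -> H) :
  (forall eps : R, 0 < eps -> exists N, forall n m, (N <= n <= m)%N ->
    rnorm (s m - s n) < eps) -> exists x, converges s x.
Proof.
move=> h; suff : cvgn s by move=> /cvg_ex[l /cvg_converges sl]; exists l.
apply/cauchy_cvgP/cauchy_ballP => e e0.
have eE : e = (complex.Re e)%:C by rewrite RRe_real// gtr0_real.
have e0' : 0 < complex.Re e by rewrite -(ltcR 0) -eE.
have [N hN] := h _ e0'.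
exists (s @` [set n | (N <= n)%N], s @` [set n | (N <= n)%N]) => /=.
  by split; exists N => // n Nn; exists n.
move=> [_ _] /= [[n Nn <-] [m Nm <-]]; rewrite -ball_normE/= rnormE eE ltcR.
have [nm|mn] := leqP n m; last by rewrite hN// Nm ltnW.
by rewrite rdistC hN// Nn.
Qed.

Lemma bounded_opP T : bounded_op T ->
  linear T /\ exists2 M : R, 0 <= M & forall x, rnorm (T x) <= M * rnorm x.
Proof.
move=> [lT [M hM]]; split=> //; exists `|M|; first exact: normr_ge0.
move=> x; have := hM x; rewrite !rnormE -rmorphM/= lecR => /le_trans; apply.
by rewrite ler_wpM2r ?rnorm_ge0 ?ler_norm.
Qed.

Lemma bounded_opI T (M : R) : linear T ->
  (forall x, rnorm (T x) <= M * rnorm x) -> bounded_op T.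
Proof.
by move=> lT h; split=> //; exists M => x; rewrite !rnormE -rmorphM/= lecR.
Qed.

Lemma linear_lin (a : R[i]) S T : linear S -> linear T ->
  linear (fun x => a *: S x + T x).
Proof.
move=> lS lT b x y.
by rewrite lS lT scalerDr addrACA scalerDr !scalerA mulrC.
Qed.

Lemma bounded_op_lin (a : R[i]) S T : bounded_op S -> bounded_op T ->
  bounded_op (fun x => a *: S x + T x).
Proof.
move=> /bounded_opP[lS [M M0 hM]] /bounded_opP[lT [N N0 hN]].
apply: (@bounded_opI _ (rnorm a * M + N)); first exact: linear_lin.
move=> x; apply: le_trans (rnormD _ _) _; rewrite rnormZ mulrDl.
by apply: lerD => //; rewrite -mulrA ler_wpM2l ?rnorm_ge0.
Qed.

Lemma bounded_op_comp S T : bounded_op S -> bounded_op T ->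
  bounded_op (fun x => S (T x)).
Proof.
move=> /bounded_opP[lS [M M0 hM]] /bounded_opP[lT [N N0 hN]].
apply: (@bounded_opI _ (M * N)); first by move=> a x y; rewrite lT lS.
by move=> x; apply: le_trans (hM _) _; rewrite -mulrA ler_wpM2l.
Qed.

Lemma converges_bounded T (s : nat -> H) x : bounded_op T ->
  converges s x -> converges (T \o s) (T x).
Proof.
move=> /bounded_opP[lT [M _ h]]; apply: converges_map => y z.
by rewrite -(linearfB lT); exact: h.
Qed.

Lemma converges_lin (a : R[i]) (s t : nat -> H) x y :
  converges s x -> converges t y ->
  converges (fun n => a *: s n + t n) (a *: x + y).
Proof.
move=> sx ty d d0; have d2 : 0 < d / 2 by rewrite divr_gt0.
have [|N hN] := @converges_map _ _ _ ( *:%R a) (rnorm a) s x _ sx _ d2.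
  by move=> p q; rewrite -scalerBr rnormZ.
have [M hM] := ty _ d2; exists (maxn N M) => n; rewrite geq_max.
move=> /andP[/hN/= h1 /hM h2].
have := rnormD (a *: s n - a *: x) (t n - y).
rewrite opprD addrACA; lra.
Qed.

Lemma converges_dotl (s : nat -> H) x y :
  converges s x -> converges (fun n => dot (s n) y) (dot x y).
Proof.
apply: (@converges_map _ _ _ (dot^~ y) (rnorm y)) => z t.
by rewrite -dotBl mulrC; exact: dot_le.
Qed.

Lemma converges_dotr (s : nat -> H) x y :
  converges s x -> converges (fun n => dot y (s n)) (dot y x).
Proof.
apply: (@converges_map _ _ _ (dot y) (rnorm y)) => z t.
by rewrite -dotBr; exact: dot_le.
Qed.

Lemma bessel_seq (f : nat -> H) x n : orthonormal_seq dot f ->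
  \sum_(i < n) rnorm (dot x (f i)) ^+ 2 <= rnorm x ^+ 2.
Proof.
move=> of_; have := bessel dot_norm x (orthonormal_mkseq n of_).
rewrite big_map.
by rewrite -[X in iota _ X]subn0 big_mkord.
Qed.

(* The zero vector is allowed, so that [mu^-1 *: T f] qualifies when [mu = 0]. *)
Definition suborthonormal (f : nat -> H) : Prop :=
  (forall i j, i != j -> dot (f i) (f j) = 0) /\ forall i, rnorm (f i) <= 1.

Lemma orthonormal_norm (f : nat -> H) k : orthonormal_seq dot f ->
  rnorm (f k) = 1.
Proof.
move=> of_; apply: (@orthonormal_list_norm _ _ _ dot_norm (mkseq f k.+1)).
  exact: orthonormal_mkseq.
by apply/mapP; exists k => //; rewrite mem_iota add0n ltnSn.
Qed.

Lemma orthonormal_sub (f : nat -> H) :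
  orthonormal_seq dot f -> suborthonormal f.
Proof.
move=> of_; split=> [i j /negbTE ij|i]; first by rewrite of_ ij.
by rewrite orthonormal_norm.
Qed.

Lemma suborthonormal_sum (f : nat -> H) (c : nat -> R[i]) n m :
  suborthonormal f ->
  rnorm (\sum_(n <= i < m) c i *: f i) ^+ 2
    <= \sum_(n <= i < m) rnorm (c i) ^+ 2.
Proof.
move=> [of_ nf]; elim: m => [|m IH]; first by rewrite !big_geq// rnorm0 expr0n.
have [nm|mn] := leqP n m; last by rewrite !big_geq// rnorm0 expr0n.
rewrite !big_nat_recr//= (rnorm_sqrD dot_norm).
  apply: lerD => //; rewrite rnormZ exprMn ler_piMr ?sqr_ge0//.
  by rewrite exprn_ile1 ?rnorm_ge0.
rewrite dot_suml big_nat big1// => i /andP[_ im].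
by rewrite dotZl dotZr of_ ?mulr0// ltn_eqF.
Qed.

(** Riesz-Fischer: the squared norm of a block of the series is at most the matching block of a
    bounded increasing sequence of real sums. *)
Lemma series_converges (f : nat -> H) (c : nat -> R[i]) (M : R) :
  suborthonormal f -> (forall n, \sum_(i < n) rnorm (c i) ^+ 2 <= M) ->
  exists s, converges (fun n => \sum_(i < n) c i *: f i) s.
Proof.
move=> of_ h; apply: cauchy_converges => e e0.
pose S n := \sum_(i < n) rnorm (c i) ^+ 2.
have ndS : nondecreasing_seq S.
  apply/nondecreasing_seqP => n; rewrite /S big_ord_recr/= lerDl; exact: sqr_ge0.
have cS : cvgn S.
  apply: nondecreasing_is_cvgn => //; exists M => _ [n _ <-]; exact: h.
have e2 : 0 < e ^+ 2 by rewrite exprn_gt0.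
have /cvgrPdist_lt/(_ _ e2)[N _ hN] := cS.
exists N => n m /andP[Nn nm].
have nd := nondecreasing_cvgn_le ndS cS.
have SE : S m - S n = \sum_(n <= i < m) rnorm (c i) ^+ 2.
  rewrite /S -!(big_mkord xpredT (fun i => rnorm (c i) ^+ 2)).
  by rewrite (big_cat_nat (leq0n n) nm)//= addrAC subrr add0r.
have sE : \sum_(i < m) c i *: f i - \sum_(i < n) c i *: f i
    = \sum_(n <= i < m) c i *: f i.
  rewrite -!(big_mkord xpredT (fun i => c i *: f i)).
  by rewrite (big_cat_nat (leq0n n) nm)//= addrAC subrr add0r.
rewrite sE -(@ltr_pXn2r _ 2)// ?nnegrE ?rnorm_ge0 ?(ltW e0)//.
apply: le_lt_trans (suborthonormal_sum _ _ _ of_) _; rewrite -SE.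
have := hN n Nn; have := nd m; have := ler_norm (limn S - S n); rewrite /=; lra.
Qed.

Lemma dot_inj y z : (forall x, dot x y = dot x z) -> y = z.
Proof.
move=> h; apply/eqP; rewrite -subr_eq0; apply/eqP/rnorm_eq0/eqP.
rewrite -sqrf_eq0; apply/eqP/complexI; rewrite -(dotxx dot_norm) dotBr h.
by rewrite subrr.
Qed.

(** [Tad y] is defined by the only possible coefficients in the basis, [dot y (T (e l))]; this takes
    the place of the Riesz representation theorem. *)
Lemma adjoint_exists (e : nat -> H) T : orthonormal_basis dot e ->
  bounded_op T -> exists Tad, is_adjoint dot T Tad.
Proof.
move=> [oe be] bT; have [lT [M M0 hT]] := bounded_opP bT.
pose s y n := \sum_(l < n) dot y (T (e l)) *: e l.
have ns y n : rnorm (s y n) ^+ 2 = \sum_(l < n) rnorm (dot y (T (e l))) ^+ 2.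
  apply: complexI; rewrite -(dotxx dot_norm) dot_sumr rmorph_sum/=.
  apply: eq_bigr => i _; rewrite dotZr dot_suml (bigD1 i)//= dotZl oe eqxx mulr1.
  rewrite big1 ?addr0; first by rewrite mulrC mul_conjE.
  move=> j ji; rewrite dotZl oe; case: eqP => [/val_inj e0|]; last by rewrite mulr0.
  by rewrite e0 eqxx in ji.
(* For [s = s y n], |s|^2 = dot y (T s) <= M |y| |s|, uniformly in [n]. *)
have bs y n : rnorm (s y n) <= M * rnorm y.
  have : (rnorm (s y n) ^+ 2)%:C = dot y (T (s y n)).
    rewrite ns (linearf_sum lT) dot_sumr rmorph_sum/=; apply: eq_bigr => i _.
    by rewrite (linearfZ lT) dotZr mulrC mul_conjE.
  move=> /(congr1 (@rnorm R _)); rewrite rnorm_real ger0_norm ?sqr_ge0// => h.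
  have := dot_le dot_norm y (T (s y n)); rewrite -h => {}h.
  have [->|s0] := eqVneq (rnorm (s y n)) 0; first by rewrite mulr_ge0 ?rnorm_ge0.
  have sp : 0 < rnorm (s y n) by rewrite lt_neqAle eq_sym s0 rnorm_ge0.
  rewrite -(ler_pM2r sp) -expr2; apply: le_trans h _.
  by rewrite (mulrC M) -mulrA ler_wpM2l ?rnorm_ge0.
have /choice[Tad hTad] : forall y, exists z, converges (s y) z.
  move=> y; apply: (@series_converges e (fun l => dot y (T (e l))) ((M * rnorm y) ^+ 2)).
    exact: orthonormal_sub.
  by move=> n; rewrite -ns ler_pXn2r ?nnegrE ?mulr_ge0 ?rnorm_ge0.
have adj x y : dot (T x) y = dot x (Tad y).
  have h1 := converges_dotr x (hTad y).
  have h2 := converges_dotl y (converges_bounded bT (cvg_converges (be x))).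
  apply: converges_unique h2 _; apply: eq_converges h1 => n /=.
  rewrite (linearf_sum lT) dot_suml dot_sumr; apply: eq_bigr => i _.
  by rewrite (linearfZ lT) dotZl dotZr -dotC mulrC.
exists Tad; split=> //; apply: (@bounded_opI _ M).
  move=> a y z; apply: dot_inj => x.
  by rewrite -adj !dotDr !dotZr -!adj.
by move=> y; apply: (converges_le (n0 := 0) (hTad y)) => n _; exact: bs.
Qed.

Lemma adjoint_sym T Tad : is_adjoint dot T Tad ->
  forall x y, dot (Tad x) y = dot x (T y).
Proof. by move=> [_ h] x y; rewrite dotC -h -dotC. Qed.

End Operators.

(** * Singular values of compact operators *)

Section SingularSystem.
Variables (R : realType) (H : completeNormedModType R[i]).
Variable dot : {dot H for Num.conj}.
Hypothesis dot_norm : dot_induces_norm dot.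
Implicit Types (x y z : H) (u v w : seq H) (T : H -> H).

Lemma rnorm_sum_orthogonal (v : nat -> H) (a : nat -> R) (c : nat -> R[i]) n :
  (forall i j, dot (v i) (v j) = (i == j)%:R * (a i ^+ 2)%:C) ->
  rnorm (\sum_(i < n) c i *: v i) ^+ 2 = \sum_(i < n) rnorm (c i) ^+ 2 * a i ^+ 2.
Proof.
move=> h; apply: complexI; rewrite -(dotxx dot_norm) dot_suml rmorph_sum/=.
apply: eq_bigr => i _; rewrite dot_sumr (bigD1 i)//= big1 => [|j ji].
  by rewrite addr0 dotZl dotZr h eqxx mul1r mulrA mul_conjE -rmorphM.
rewrite dotZl dotZr h; case: eqP => [/val_inj e0|]; last by rewrite mul0r !mulr0.
by rewrite e0 eqxx in ji.
Qed.

(* One half of the min-max principle: [T] is at least [a k] on the span of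
   [f 0, .., f k], which meets the orthogonal complement of [w]. *)
Lemma minimax T (f : nat -> H) (a : nat -> R) w k (d : R) :
  linear T -> orthonormal_seq dot f -> nonincreasing_seq a ->
  (forall i, 0 <= a i) ->
  (forall i j, dot (T (f i)) (T (f j)) = (i == j)%:R * (a i ^+ 2)%:C) ->
  (size w <= k)%N ->
  (forall x, perp dot x w -> rnorm (T x) <= d * rnorm x) -> a k <= d.
Proof.
move=> lT of_ da a0 hT wk hd.
have [c /=[x0 px]] := perp_combination of_ wk; set x := \sum_(i < _) _ in x0 px.
have nx : 0 < rnorm x.
  by rewrite lt_neqAle rnorm_ge0 andbT eq_sym; apply/eqP => /rnorm_eq0.
rewrite -(ler_pM2r nx); apply: le_trans (hd _ px).
rewrite -(@ler_pXn2r _ 2)// ?nnegrE ?mulr_ge0 ?rnorm_ge0// exprMn.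
have -> : rnorm x ^+ 2 = \sum_(i < k.+1) rnorm (c i) ^+ 2.
  rewrite (@rnorm_sum_orthogonal f (fun=> 1)); last first.
    by move=> i j; rewrite of_ expr1n mulr1.
  by apply: eq_bigr => i _; rewrite expr1n mulr1.
have -> : T x = \sum_(i < k.+1) c i *: T (f i).
  by rewrite (linearf_sum lT); apply: eq_bigr => i _; rewrite (linearfZ lT).
rewrite (rnorm_sum_orthogonal _ _ hT) mulr_sumr; apply: ler_sum => i _.
rewrite mulrC ler_wpM2l ?sqr_ge0// ler_pXn2r ?nnegrE//; apply: da.
by rewrite -ltnS.
Qed.

(** [s] is the projection of [x] on the closed span of [f], which may be a proper subspace: singular
    vectors can miss part of the kernel. *)
Lemma orthonormal_expansion (f : nat -> H) x : orthonormal_seq dot f ->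
  exists s, converges (fun n => \sum_(k < n) dot x (f k) *: f k) s /\
    forall k, dot (x - s) (f k) = 0.
Proof.
move=> of_.
have [s hs] := @series_converges _ _ _ dot_norm _ (fun k => dot x (f k)) _
  (orthonormal_sub dot_norm of_) (fun n => bessel_seq dot_norm x n of_).
exists s; split=> // k; rewrite dotBl; apply/eqP; rewrite subr_eq0; apply/eqP.
apply: converges_unique (converges_dotl dot_norm (f k) hs).
(* The [k]-th coefficient of the partial sums is constant once [n > k]. *)
apply: (@tail_converges _ _ (fun=> dot x (f k)) _ _ k.+1) => [n kn|].
  rewrite dot_suml (bigD1 (Ordinal kn))//= dotZl of_ eqxx mulr1 big1 ?addr0//.
  move=> i ik; rewrite dotZl of_; case: eqP => [e0|]; last by rewrite mulr0.
  by move: ik; rewrite -val_eqE/= e0 eqxx.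
exact: converges_const.
Qed.

(** The content of [is_singular_values] with its witnesses exposed, because the singular vectors
    themselves are used later. *)
Definition singular_system T Tad (f : nat -> H) (mu : nat -> R) : Prop :=
  [/\ nonincreasing_seq mu, forall k, 0 <= mu k, orthonormal_seq dot f,
      forall k, Tad (T (f k)) = (mu k ^+ 2)%:C *: f k &
      forall x, (forall k, dot x (f k) = 0) -> Tad (T x) = 0].

Lemma is_singular_valuesP T mu : is_singular_values dot T mu ->
  exists Tad f, is_adjoint dot T Tad /\ singular_system T Tad f mu.
Proof. by move=> [h1 h2 [Tad [f [h3 h4 h5 h6]]]]; exists Tad, f; split. Qed.

Section System.
Variables (T Tad : H -> H) (f : nat -> H) (mu : nat -> R).
Hypotheses (bT : bounded_op T) (adj : is_adjoint dot T Tad).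
Hypothesis ss : singular_system T Tad f mu.

Lemma singular_dot i j :
  dot (T (f i)) (T (f j)) = (i == j)%:R * (mu i ^+ 2)%:C.
Proof.
have [_ _ of_ ef _] := ss; have [_ h] := adj.
rewrite h ef dotZr of_; case: eqP => [->|]; last by rewrite mulr0 mul0r.
by rewrite conjC_real mul1r mulr1.
Qed.

Lemma singular_norm k : rnorm (T (f k)) = mu k.
Proof.
have [_ m0 _ _ _] := ss.
apply/eqP; rewrite -(@eqrXn2 _ 2)// ?rnorm_ge0//; apply/eqP/complexI.
by rewrite -(dotxx dot_norm) singular_dot eqxx mul1r.
Qed.

Lemma singular_kernel x : (forall k, dot x (f k) = 0) -> T x = 0.
Proof.
have [_ _ _ _ h0] := ss; have [_ h] := adj.
move=> /h0 e0; apply: rnorm_eq0; apply/eqP; rewrite -sqrf_eq0; apply/eqP/complexI.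
by rewrite -(dotxx dot_norm) h e0 dot0r.
Qed.

Lemma singular_expansion x :
  converges (fun n => \sum_(k < n) dot x (f k) *: T (f k)) (T x).
Proof.
have [_ _ of_ _ _] := ss; have [lT _] := bT.
have [s [hs xs]] := orthonormal_expansion x of_.
have -> : T x = T s.
  by apply/eqP; rewrite -subr_eq0 -(linearfB lT) singular_kernel.
apply: eq_converges (converges_bounded bT hs) => n /=.
by rewrite (linearf_sum lT); apply: eq_bigr => i _; rewrite (linearfZ lT).
Qed.

(** In [singular_expansion] the terms below [N] vanish, and the remaining images are orthogonal with
    norms at most [mu N]. *)
Lemma singular_tail N x : perp dot x (mkseq f N) ->
  rnorm (T x) <= mu N * rnorm x.
Proof.
have [dmu m0 of_ _ _] := ss; move=> px.
apply: (converges_le (n0 := 0) (singular_expansion x)) => n _.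
rewrite -(@ler_pXn2r _ 2)// ?nnegrE ?mulr_ge0 ?rnorm_ge0// exprMn.
have -> : rnorm (\sum_(k < n) dot x (f k) *: T (f k)) ^+ 2 =
    \sum_(i < n) rnorm (dot x (f i)) ^+ 2 * mu i ^+ 2.
  exact: (rnorm_sum_orthogonal (fun k => dot x (f k)) n singular_dot).
apply: (@le_trans _ _ (mu N ^+ 2 * \sum_(i < n) rnorm (dot x (f i)) ^+ 2)).
  rewrite mulr_sumr; apply: ler_sum => i _.
  have [iN|Ni] := ltnP i N.
    rewrite px ?rnorm0 ?expr0n ?mul0r ?mulr0//.
    by apply/mapP; exists (i : nat); rewrite // mem_iota.
  by rewrite mulrC ler_wpM2r ?sqr_ge0// ler_pXn2r ?nnegrE//; exact: dmu.
by rewrite ler_wpM2l ?sqr_ge0// bessel_seq.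
Qed.

(** Turns a bound off any finite list, in particular off a member of an adapted family, back into a
    bound on singular values. *)
Lemma singular_minimax w k (d : R) : (size w <= k)%N ->
  (forall x, perp dot x w -> rnorm (T x) <= d * rnorm x) -> mu k <= d.
Proof.
have [dmu m0 of_ _ _] := ss; have [lT _] := bT.
by apply: minimax => //; exact: singular_dot.
Qed.

End System.

End SingularSystem.

(** * Existence of singular values *)

Section Existence.
Variables (R : realType) (H : completeNormedModType R[i]).
Variable dot : {dot H for Num.conj}.
Hypothesis dot_norm : dot_induces_norm dot.
Implicit Types (x y z : H) (u v w : seq H) (T : H -> H).

(** A cluster point of the image sequence is within [m.+1%:R^-1] of some term of index at least [m].
    The choice [phi] need not be increasing: [m <= phi m] suffices. *)
Lemma compact_subsequence T (s : nat -> H) : compact_op T ->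
  (forall n, rnorm (s n) <= 1) -> exists y (phi : nat -> nat),
    (forall m, (m <= phi m)%N) /\ converges (fun m => T (s (phi m))) y.
Proof.
move=> [_ [B TB [cB _]]] s1.
have FB : (T \o s @ \oo) B.
  exists 0%N => // n _ /=; apply: TB; exists (s n) => //=.
  by rewrite rnormE lecR.
have [y [_ cy]] := cB (T \o s @ \oo) _ FB.
have h m : exists n, (m <= n)%N /\ rnorm (T (s n) - y) < m.+1%:R^-1.
  have F1 : (T \o s @ \oo) ((T \o s) @` [set n | (m <= n)%N]).
    by exists m => // n mn; exists n.
  have e0 : 0 < (m.+1%:R^-1)%:C :> R[i] by rewrite (ltcR 0) invr_gt0.
  have [_ [[n mn <-]]] := cy _ _ F1 (nbhsx_ballx y _ e0).
  rewrite -ball_normE/= rnormE ltcR rdistC => h; by exists n.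
have [phi hphi] := choice h; exists y, phi; split=> [m|]; first by have [] := hphi m.
apply: (@converges_sqr_rate _ _ _ _ 1) => m; have [_ /ltW h1] := hphi m.
rewrite mul1r expr2; apply: le_trans h1; rewrite ler_piMl ?rnorm_ge0//.
by apply: le_trans (ltW (hphi m).2) _; rewrite invf_le1 ?ltr0n// ler1n.
Qed.

(* A maximising sequence for [rnorm (T x)] on the unit sphere of the orthogonal
   complement of [u] is nearly fixed by [s^-2 T^* T], so it converges along the
   subsequence given by compactness of [T]. *)
Lemma norm_attained T Tad (e : nat -> H) u :
  compact_op T -> bounded_op T -> is_adjoint dot T Tad ->
  orthonormal_seq dot e ->
  (forall x, x \in u -> exists a : R[i], Tad (T x) = a *: x) ->
  exists z, [/\ rnorm z = 1, perp dot z u,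
    Tad (T z) = (rnorm (T z) ^+ 2)%:C *: z &
    forall x, perp dot x u -> rnorm (T x) <= rnorm (T z) * rnorm x].
Proof.
move=> cT bT adj oe eu; have [lT [M M0 hM]] := bounded_opP bT.
have [bTad hadj] := adj; have [lTad _] := bounded_opP bTad.
pose S := [set rnorm (T x) | x in [set x | rnorm x = 1 /\ perp dot x u]].
have S0 : S !=set0.
  by have [x hx] := orthogonal_unit u oe; exists (rnorm (T x)); exists x.
have hS : has_sup S.
  by split=> //; exists M => _ [x [x1 _] <-]; rewrite -[M]mulr1 -x1.
pose s := sup S.
have les x : perp dot x u -> rnorm (T x) <= s * rnorm x.
  move=> px; have [->|/eqP x0] := eqVneq x 0.
    by rewrite (linearf0 lT) !rnorm0 mulr0.
  have nx : 0 < rnorm x.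
    by rewrite lt_neqAle rnorm_ge0 andbT eq_sym; apply/eqP => /rnorm_eq0.
  rewrite -ler_pdivrMr// mulrC; apply: (sup_upper_bound hS).
  exists ((rnorm x)^-1%:C *: x).
    split; first exact: normalized.
    by move=> y yw; rewrite dotZl px// mulr0.
  by rewrite (linearfZ lT) rnormZ rnorm_real ger0_norm// invr_ge0 rnorm_ge0.
have s0 : 0 <= s.
  by have [r Sr] := S0; apply: le_trans (sup_upper_bound hS Sr);
     have [x _ <-] := Sr; exact: rnorm_ge0.
(* If [s = 0], then [T] vanishes on the complement and any unit vector there will do. *)
have [s00|sneq0] := eqVneq s 0.
  have [z [z1 pz]] := orthogonal_unit u oe; exists z.
  have Tz : T z = 0.
    by apply: rnorm_eq0; apply/eqP; rewrite eq_le rnorm_ge0 andbT;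
       have := les _ pz; rewrite s00 mul0r.
  split=> //; first by rewrite Tz (linearf0 lTad) rnorm0 expr0n scale0r.
  by move=> x /les; rewrite s00 Tz rnorm0.
have sp : 0 < s by rewrite lt_neqAle eq_sym sneq0.
have hx n : exists x, [/\ rnorm x = 1, perp dot x u & s - n.+1%:R^-1 < rnorm (T x)].
  have e0 : 0 < n.+1%:R^-1 :> R by rewrite invr_gt0.
  by have [_ [x [x1 px] <-]] := sup_adherent e0 hS; exists x.
have /choice[xx hxx] := hx.
have [|y [phi [hphi cy]]] := @compact_subsequence T xx cT.
  by move=> n; have [->] := hxx n.
pose x' m := xx (phi m).
have x1 m : rnorm (x' m) = 1 by have [] := hxx (phi m).
have px m : perp dot (x' m) u by have [] := hxx (phi m).
have cTad := converges_bounded bTad cy.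
(* Since [u] consists of eigenvectors of T^* T, its complement is invariant, and the bound [les]
   applies to [Tad (T x)] as well. *)
have Tadperp x : perp dot x u -> perp dot (Tad (T x)) u.
  move=> hpx v vu; have [a ea] := eu _ vu.
  by rewrite (adjoint_sym adj) hadj ea dotZr hpx// mulr0.
have Tadle x : perp dot x u -> rnorm (Tad (T x)) <= s ^+ 2 * rnorm x.
  move=> hpx; set w := Tad (T x).
  have [->|w0] := eqVneq (rnorm w) 0; first by rewrite mulr_ge0 ?sqr_ge0 ?rnorm_ge0.
  have wp : 0 < rnorm w by rewrite lt_neqAle eq_sym w0 rnorm_ge0.
  have : rnorm (dot w w) <= rnorm (T x) * rnorm (T w).
    by rewrite {1}/w (adjoint_sym adj); exact: dot_le.
  rewrite (dotxx dot_norm) rnorm_real ger0_norm ?sqr_ge0// => h.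
  rewrite -(ler_pM2r wp) -expr2; apply: le_trans h _.
  rewrite expr2 (_ : s * s * _ * _ = (s * rnorm x) * (s * rnorm w)); last first.
    by rewrite !mulrA (mulrAC s).
  by rewrite ler_pM ?rnorm_ge0 ?les//; exact: Tadperp.
pose z := (s ^- 2)%:C *: Tad y.
have s2 : s ^+ 2 != 0 by rewrite expf_neq0.
have cx : converges x' z.
  have c1 : converges (fun m => (s ^- 2)%:C *: Tad (T (x' m))) z.
    apply: (@converges_map _ _ _ ( *:%R (s ^- 2)%:C) (s ^- 2)) cTad => p q.
    by rewrite -scalerBr rnormZ rnorm_real ger0_norm// invr_ge0 sqr_ge0.
  (* The squared norm is at most 1 + 1 - 2 s^-2 |T x'|^2; with |T x'| >= s - 1/(m+1) this is at most
     4 / (s (m+1)). *)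
  have c2 : converges (fun m => x' m - (s ^- 2)%:C *: Tad (T (x' m))) 0.
    apply: (@converges_sqr_rate _ _ _ _ (4 / s)) => m.
    rewrite subr0 (rnorm_sqrB_real dot_norm (r := s ^- 2 * rnorm (T (x' m)) ^+ 2)).
      rewrite x1 rnormZ rnorm_real ger0_norm ?invr_ge0 ?sqr_ge0// expr1n.
      set t := rnorm (T (x' m)).
      have a1 : s ^- 2 * rnorm (Tad (T (x' m))) <= 1.
        by rewrite mulrC ler_pdivrMr ?exprn_gt0// mul1r;
           have := Tadle _ (px m); rewrite x1 mulr1.
      have a2 : s - m.+1%:R^-1 <= t.
        have [_ _ /ltW] := hxx (phi m); apply: le_trans.
        by rewrite lerD2l lerN2 lef_pV2 ?posrE// ler_nat ltnS.
      have a3 : t <= s by have := les _ (px m); rewrite x1 mulr1.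
      have t0 : 0 <= t := rnorm_ge0 _.
      have a4 : (s ^- 2 * rnorm (Tad (T (x' m)))) ^+ 2 <= 1.
        by rewrite expr_le1// mulr_ge0 ?invr_ge0 ?sqr_ge0 ?rnorm_ge0.
      have a5 : s ^- 2 * t ^+ 2 = 1 - s ^- 2 * ((s - t) * (s + t)).
        by rewrite -subr_sqr mulrBr mulVf// opprB addrC subrK.
      have a6 : s ^- 2 * ((s - t) * (s + t)) <= s ^- 2 * (m.+1%:R^-1 * (2 * s)).
        rewrite ler_wpM2l ?invr_ge0 ?sqr_ge0// ler_pM ?subr_ge0 ?addr_ge0//.
          by move: a2; move: (m.+1%:R^-1) => d; lra.
        by move: a3; move: (t) (s) => t' s'; lra.
      have a7 : s ^- 2 * (m.+1%:R^-1 * (2 * s)) = 2 / s / m.+1%:R.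
        by move: (m.+1%:R^-1) => d; field.
      have a8 : 4 / s / m.+1%:R = 2 * (2 / s / m.+1%:R) by ring.
      rewrite a5 a8 -a7; move: a4 a6.
      move: (s ^- 2 * ((s - t) * (s + t))) (s ^- 2 * (m.+1%:R^-1 * (2 * s))).
      by move: ((s ^- 2 * rnorm (Tad (T (x' m)))) ^+ 2) => X Y Z; lra.
    rewrite dotZr conjC_real -hadj (dotxx dot_norm) -rmorphM//.
  move=> e0 e00; have e2 : 0 < e0 / 2 by rewrite divr_gt0.
  have [N1 h1] := c1 _ e2; have [N2 h2] := c2 _ e2.
  exists (maxn N1 N2) => n; rewrite geq_max => /andP[/h1 {}h1 /h2].
  rewrite subr0 => {}h2.
  have := rnormD (x' n - (s ^- 2)%:C *: Tad (T (x' n)))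
                 ((s ^- 2)%:C *: Tad (T (x' n)) - z).
  rewrite addrA subrK; lra.
have z1 : rnorm z = 1 by exact: converges_norm cx x1.
have pz : perp dot z u.
  move=> v vu; apply: converges_unique (converges_dotl dot_norm v cx) _.
  by apply: eq_converges (converges_const 0) => n /=; rewrite px.
have Tz : T z = y by apply: converges_unique (converges_bounded bT cx) cy.
have eTz : Tad (T z) = (s ^+ 2)%:C *: z.
  by rewrite Tz /z scalerA -rmorphM/= mulfV// scale1r.
have nTz : rnorm (T z) = s.
  apply/eqP; rewrite -(@eqrXn2 _ 2)// ?rnorm_ge0//; apply/eqP/complexI.
  by rewrite -(dotxx dot_norm) hadj eTz dotZr conjC_real (dotxx dot_norm) z1 expr1n mulr1.
by exists z; rewrite nTz; split.
Qed.

Lemma compact_bounded T : compact_op T -> bounded_op T.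
Proof.
move=> cT; have [lT _] := cT.
suff [M hM] : exists M : R, forall x, rnorm x <= 1 -> rnorm (T x) <= M.
  apply: (@bounded_opI _ _ _ M lT) => x.
  have [->|/eqP x0] := eqVneq x 0; first by rewrite (linearf0 lT) !rnorm0 mulr0.
  have nx : 0 < rnorm x.
    by rewrite lt_neqAle rnorm_ge0 andbT eq_sym; apply/eqP => /rnorm_eq0.
  rewrite -ler_pdivrMr// mulrC.
  have := hM ((rnorm x)^-1%:C *: x); rewrite normalized// => /(_ (lexx _)).
  by rewrite (linearfZ lT) rnormZ rnorm_real ger0_norm// invr_ge0 rnorm_ge0.
apply: contrapT => nb.
have /choice[s hs] : forall n : nat, exists x, rnorm x <= 1 /\ n%:R < rnorm (T x).
  move=> n; apply: contrapT => h; apply: nb; exists n%:R => x x1.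
  by rewrite leNgt; apply/negP => Tx; apply: h; exists x.
have [|y [phi [hphi cy]]] := @compact_subsequence T s cT.
  by move=> n; have [] := hs n.
have [N hN] := cy 1 ltr01; pose m := maxn N (Num.truncn (rnorm y + 1)).+1.
have h1 := hN m (leq_maxl _ _).
have [_ h2] := hs (phi m).
have h3 : rnorm y + 1 < m%:R.
  by apply: lt_le_trans (truncnS_gt _) _; rewrite ler_nat leq_maxr.
have h4 : m%:R <= (phi m)%:R :> R by rewrite ler_nat.
have := rnormD (T (s (phi m)) - y) y; rewrite subrK; lra.
Qed.

(** Spectral theorem for T^* T: each new vector maximises |T x| on the unit sphere of the complement
    of the previous ones. *)
Lemma singular_values_exist T (e : nat -> H) : orthonormal_basis dot e ->
  compact_op T -> bounded_op T -> exists mu, is_singular_values dot T mu.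
Proof.
move=> be cT bT; have [oe _] := be; have [lT [M M0 hM]] := bounded_opP bT.
have [Tad adj] := adjoint_exists dot_norm be bT.
pose eigen u := forall x, x \in u -> exists a : R[i], Tad (T x) = a *: x.
(* The default 0 concerns lists that do not consist of eigenvectors; the lists [L n] always do. *)
have /choice[next hnext] : forall u, exists z, eigen u ->
    [/\ rnorm z = 1, perp dot z u,
      Tad (T z) = (rnorm (T z) ^+ 2)%:C *: z &
      forall x, perp dot x u -> rnorm (T x) <= rnorm (T z) * rnorm x].
  move=> u; have [h|h] := pselect (eigen u); last by exists 0.
  by have [z hz] := norm_attained cT bT adj oe h; exists z.
pose L := fix L n := if n is m.+1 then rcons (L m) (next (L m)) else [::].
pose f n := next (L n).
have LE n : L n = mkseq f n by elim: n => // n IH; rewrite mkseqS -IH.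
have eL n : eigen (L n).
  elim: n => [|n IH] v //=; rewrite mem_rcons inE => /orP[/eqP->|/IH//].
  by have [_ _ -> _] := hnext _ IH; eexists.
have fP n := hnext _ (eL n).
have oL n : orthonormal_list dot (L n).
  elim: n => [|n IH] /=; first exact: orthonormal_list_nil.
  by have [f1 pf _ _] := fP n; exact: orthonormal_list_rcons.
have of_ : orthonormal_seq dot f.
  by apply: orthonormal_seq_mkseq => n; rewrite -LE.
pose mu k := rnorm (T (f k)).
have dmu : nonincreasing_seq mu.
  (* [f n.+1] is admissible in the maximisation that defines [f n]. *)
  apply/nonincreasing_seqP => n; have [_ _ _ hn] := fP n.
  have [f1 pf _ _] := fP n.+1; rewrite -[leRHS]mulr1 -f1; apply: hn => v vL.
  by apply: pf; rewrite /= mem_rcons inE vL orbT.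
have ef k : Tad (T (f k)) = (mu k ^+ 2)%:C *: f k by have [] := fP k.
have [bTad hadj] := adj; have [lTad _] := bounded_opP bTad.
(* The images [T (f k)] are orthogonal of norm [mu k], and compactness brings two of them
   arbitrarily close. *)
have mu0 : forall d : R, 0 < d -> exists k, mu k < d.
  move=> d d0; have [|y [phi [hphi cy]]] := @compact_subsequence T f cT.
    by move=> n; have [->] := fP n.
  have d2 : 0 < d / 2 by rewrite divr_gt0.
  have [N hN] := cy _ d2; exists (phi N).
  (* Since [m] exceeds [phi N], so does [phi m], and the two indices differ. *)
  pose m := (maxn N (phi N).+1).
  have h1 := hN _ (leqnn N); have h2 := hN m (leq_maxl _ _).
  have nphi : phi N != phi m.
    rewrite neq_ltn; apply/orP; left; apply: leq_trans (hphi m).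
    exact: leq_maxr.
  have h3 : rnorm (T (f (phi N)) - T (f (phi m))) < d.
    have := rnormD (T (f (phi N)) - y) (y - T (f (phi m))).
    by rewrite addrA subrK (rdistC y); lra.
  have : mu (phi N) ^+ 2 < d ^+ 2.
    apply: le_lt_trans (_ : rnorm (T (f (phi N)) - T (f (phi m))) ^+ 2 < _).
      rewrite (rnorm_sqrB dot_norm) ?lerDl ?sqr_ge0//.
      by rewrite hadj ef dotZr of_ (negbTE nphi) mulr0.
    by rewrite ltr_pXn2r ?nnegrE ?rnorm_ge0// ltW.
  by rewrite ltr_pXn2r ?nnegrE ?rnorm_ge0// ltW.
exists mu; split=> //; first by move=> k; exact: rnorm_ge0.
exists Tad, f; split=> // x px.
suff -> : T x = 0 by exact: linearf0.
apply: rnorm_eq0; apply/eqP; rewrite eq_le rnorm_ge0 andbT.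
apply/ler_addgt0Pr => d d0; rewrite add0r.
have [x0|x0] := eqVneq (rnorm x) 0.
  by apply: le_trans (hM _) _; rewrite x0 mulr0 ltW.
have nx : 0 < rnorm x by rewrite lt_neqAle eq_sym x0 rnorm_ge0.
have [k hk] := mu0 _ (divr_gt0 d0 nx).
have [_ _ _ hn] := fP k; apply: le_trans (hn x _) _.
  by move=> v; rewrite LE => /mapP[i _ ->].
by rewrite -ler_pdivlMr// ltW.
Qed.

End Existence.

(** * Traces over adapted systems *)

Section Trace.
Variables (R : realType) (H : completeNormedModType R[i]).
Variable dot : {dot H for Num.conj}.
Hypothesis dot_norm : dot_induces_norm dot.
Implicit Types (x y z : H) (u v w : seq H) (T X : H -> H).

Lemma trace_on_extend X u v : linear X -> orthonormal_list dot u -> orthonormal_list dot v ->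
  exists u' v', [/\ orthonormal_list dot (u ++ u') /\ (size u' <= size v)%N,
    orthonormal_list dot (v ++ v') /\ (size v' <= size u)%N &
    trace_on dot X u + trace_on dot X u' = trace_on dot X v + trace_on dot X v'].
Proof.
move=> lX ou ov.
have [u' [ou' su pu]] := gram_schmidt dot_norm v ou.
have [v' [ov' sv pv]] := gram_schmidt dot_norm u ov.
exists u', v'; split=> //; rewrite -!trace_on_cat.
by apply: (trace_on_span dot_norm) => // x; rewrite pu pv; split=> -[].
Qed.

Lemma trace_on_rest X u u' n (d : R) : 0 <= d -> orthonormal_list dot (u ++ u') ->
  (size u' <= n)%N ->
  (forall x, perp dot x u -> rnorm (X x) <= d * rnorm x) ->
  rnorm (trace_on dot X u') <= n%:R * d.
Proof.
move=> d0 ou sn h; have ou' := orthonormal_list_catr ou.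
apply: (@le_trans _ _ ((size u')%:R * d)); last first.
  by rewrite ler_wpM2r// ler_nat.
apply: trace_on_le => // y yu'; rewrite -[d]mulr1 -(orthonormal_list_norm dot_norm ou' yu').
by apply: h; exact: orthonormal_list_cat_perp ou yu'.
Qed.

Lemma trace_on_diff X u v (d : R) : 0 <= d ->
  linear X -> orthonormal_list dot u -> orthonormal_list dot v ->
  (forall x, perp dot x u -> rnorm (X x) <= d * rnorm x) ->
  (forall x, perp dot x v -> rnorm (X x) <= d * rnorm x) ->
  rnorm (trace_on dot X u - trace_on dot X v) <= ((size u)%:R + (size v)%:R) * d.
Proof.
move=> d0 lX ou ov hu hv.
have [u' [v' [[ou' su] [ov' sv] e]]] := trace_on_extend lX ou ov.
have -> : trace_on dot X u - trace_on dot X v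
    = trace_on dot X v' - trace_on dot X u'.
  by apply/eqP; rewrite subr_eq addrAC (addrC (trace_on dot X v')) -e addrK.
apply: le_trans (rnormB _ _) _; rewrite mulrDl.
by apply: lerD; [exact: trace_on_rest hv|exact: trace_on_rest hu].
Qed.

(** The adapted families; [N.+1] keeps the denominator nonzero. *)
Definition approximates X (u : nat -> seq H) : Prop :=
  (forall N, orthonormal_list dot (u N)) /\
  exists2 C : R, 0 <= C & forall N, (size (u N))%:R <= C * N.+1%:R /\
    forall x, perp dot x (u N) -> rnorm (X x) <= C / N.+1%:R * rnorm x.

Lemma approximates_diff X (u v : nat -> seq H) : linear X ->
  approximates X u -> approximates X v ->
  exists K : R,
    forall N, rnorm (trace_on dot X (u N) - trace_on dot X (v N)) <= K.
Proof.
move=> lX [ou [C C0 hu]] [ov [D D0 hv]].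
exists ((C + D) * (C + D)) => N.
have [su pu] := hu N; have [sv pv] := hv N.
have n0 : 0 < N.+1%:R :> R by rewrite ltr0n.
apply: le_trans (@trace_on_diff _ _ _ ((C + D) / N.+1%:R) _ lX (ou N) (ov N) _ _) _.
- by rewrite divr_ge0 ?addr_ge0.
- move=> x /pu/le_trans; apply; rewrite ler_wpM2r ?rnorm_ge0//.
  by rewrite ler_wpM2r ?invr_ge0// lerDl.
- move=> x /pv/le_trans; apply; rewrite ler_wpM2r ?rnorm_ge0//.
  by rewrite ler_wpM2r ?invr_ge0// lerDr.
- rewrite mulrA ler_pdivrMr// [leRHS]mulrAC ler_wpM2r ?addr_ge0//.
  by rewrite mulrDl lerD.
Qed.

Definition trace_means X (u : nat -> seq H) (N : nat) : R[i] :=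
  trace_on dot X (u N) / (ln N.+2%:R)%:C.

Lemma trace_on_mkseq X (f : nat -> H) n :
  trace_on dot X (mkseq f n) = \sum_(i < n) dot (X (f i)) (f i).
Proof.
by rewrite /trace_on big_map -[X in iota _ X]subn0 big_mkord.
Qed.

End Trace.

(** * Singular states and logarithmic means *)

Section Omega.
Variables (R : realType) (omega : (nat -> R[i]) -> R[i]).
Hypothesis omega_singular : singular_state omega.

Lemma lnS2_ge (N : nat) : ln 2 <= ln N.+2%:R :> R.
Proof. by rewrite ler_ln ?posrE ?ltr0n// ler_nat. Qed.

Lemma lnS2_gt0 (N : nat) : 0 < ln N.+2%:R :> R.
Proof. by rewrite ln_gt0// ltr1n. Qed.

Lemma ell_inftyP (x : nat -> R[i]) (M : R) :
  (forall n, rnorm (x n) <= M) -> ell_infty x.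
Proof. by move=> h; exists M => n; rewrite rnormE lecR. Qed.

Lemma c_zero_log (x : nat -> R[i]) (K : R) :
  (forall N, rnorm (x N) <= K / ln N.+2%:R) -> c_zero x.
Proof.
move=> h; apply/cvgrPdist_lt => e e0.
have eE : e = (complex.Re e)%:C by rewrite RRe_real// gtr0_real.
have e0' : 0 < complex.Re e by rewrite -(ltcR 0) -eE.
(* Beyond the exponential of K/eps, the logarithm exceeds K/eps. *)
exists (Num.truncn (expR (K / complex.Re e))).+1 => // N /= hN.
rewrite sub0r normrN.
rewrite (_ : `|x N| = (rnorm (x N))%:C) ?rnormE// eE ltcR.
apply: le_lt_trans (h N) _; rewrite ltr_pdivrMr ?lnS2_gt0// mulrC -ltr_pdivrMr//.
rewrite -[ltLHS]expRK ltr_ln ?posrE ?expR_gt0 ?ltr0n//.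
by apply: lt_le_trans (truncnS_gt _) _; rewrite ler_nat; do 2!apply: leqW.
Qed.

(** Bounded differences of traces become null sequences after division by the logarithm. Boundedness
    of [y] is also concluded, because [omega] is constrained on bounded sequences only. *)
Lemma omega_eq (x y : nat -> R[i]) (K : R) : ell_infty x ->
  (forall N, rnorm (x N - y N) <= K / ln N.+2%:R) ->
  ell_infty y /\ omega y = omega x.
Proof.
have [lin _ _ null] := omega_singular.
move=> [M hM] h.
have dx : ell_infty (fun N => x N - y N).
  apply: (@ell_inftyP _ (`|K| / ln 2)) => N; apply: le_trans (h N) _.
  apply: le_trans (_ : `|K| / ln N.+2%:R <= _).
    by rewrite ler_wpM2r ?invr_ge0 ?(ltW (lnS2_gt0 _))// ler_norm.
  by rewrite ler_wpM2l// lef_pV2 ?posrE ?lnS2_gt0 ?lnS2_ge// ln_gt0// ltr1n.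
have xb : ell_infty x by exists M.
have -> : y = (fun N => (-1) * (x N - y N) + x N).
  by apply/funext => N; rewrite mulN1r opprB subrK.
split.
  have [D hD] := dx; apply: (@ell_inftyP _ (D + M)) => n.
  apply: le_trans (rnormD _ _) _; rewrite mulN1r rnormN.
  by apply: lerD; rewrite -lecR -rnormE.
by rewrite lin// (null _ (c_zero_log h)) mulr0 add0r.
Qed.

(** Each term satisfies 1/(n+1) <= 2/(n+2) <= 2 (ln (n+2) - ln (n+1)); the factor 2 pays for the
    shift of index. *)
Lemma harmonic_le n : \sum_(k < n) k.+1%:R^-1 <= 2 * ln n.+1%:R :> R.
Proof.
elim: n => [|n IH]; first by rewrite big_ord0 ln1 mulr0.
rewrite big_ord_recr/=; apply: le_trans (lerD IH (lexx _)) _.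
have h : ln n.+1%:R - ln n.+2%:R <= - n.+2%:R^-1 :> R.
  rewrite -ln_div ?posrE ?ltr0n//.
  have -> : n.+1%:R / n.+2%:R = 1 - n.+2%:R^-1 :> R.
    rewrite -[X in X - _](@mulfV _ n.+2%:R) ?pnatr_eq0// -[X in _ - X]mul1r.
    by rewrite -mulrBl -(natr1 n.+1) addrK.
  apply: le_ln1Dx; rewrite ltrN2 invf_lt1 ?ltr0n// ltr1n//.
have h2 : n.+1%:R^-1 <= 2 * n.+2%:R^-1 :> R.
  rewrite ler_pdivlMr ?ltr0n// mulrC ler_pdivrMr ?ltr0n// -natrM ler_nat.
  by rewrite mul2n -addnn addSn addnS !ltnS leq_addr.
by move: h h2; move: (n.+1%:R^-1) (n.+2%:R^-1) => a b; lra.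
Qed.

End Omega.

Section WeakTraceClass.
Variables (R : realType) (H : completeNormedModType R[i]).
Variable dot : {dot H for Num.conj}.
Hypothesis dot_norm : dot_induces_norm dot.
Variable e : nat -> H.
Hypothesis e_basis : orthonormal_basis dot e.
Implicit Types (x y z : H) (u v w : seq H) (S T X : H -> H).

Lemma singular_valuesP T : compact_op T ->
  exists Tad f, is_adjoint dot T Tad /\
    singular_system dot T Tad f (singular_values dot T).
Proof.
move=> cT; apply: is_singular_valuesP; apply: xgetPex.
exact: singular_values_exist e_basis cT (compact_bounded cT).
Qed.

Lemma weak_schatten_bound (p : R) T : weak_schatten dot p T ->
  exists2 C : R, 0 <= C &
    forall k, singular_values dot T k <= C * k.+1%:R `^ (- p^-1).
Proof.
move=> [_ [C hC]]; exists `|C|; first exact: normr_ge0.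
move=> k; apply: le_trans (hC k) _; rewrite nat1r.
by rewrite ler_wpM2r ?powR_ge0 ?ler_norm.
Qed.

Lemma weak_schatten1_bound T : weak_schatten dot 1 T ->
  exists2 C : R, 0 <= C & forall k, singular_values dot T k <= C / k.+1%:R.
Proof.
move=> /weak_schatten_bound[C C0 hC]; exists C => // k.
by have := hC k; rewrite invr1 powR_inv1.
Qed.

(** The second clause anchors boundedness: for every other adapted family it is derived from the
    family of singular vectors. *)
Lemma weak_schatten1_approx T Tad f : weak_schatten dot 1 T ->
  is_adjoint dot T Tad -> singular_system dot T Tad f (singular_values dot T) ->
  approximates dot T (fun N => mkseq f N.+1) /\
  ell_infty (trace_means dot T (fun N => mkseq f N.+1)).
Proof.
move=> wT adj ss; have [cT _] := wT; have bT := compact_bounded cT.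
have [_ _ of_ _ _] := ss.
have [C C0 hC] := weak_schatten1_bound wT; split.
  split=> [N|]; first exact: orthonormal_mkseq.
  exists (C + 1); first by rewrite addr_ge0.
  move=> N; split.
    by rewrite size_mkseq ler_peMl// lerDr.
  move=> x px; apply: le_trans (singular_tail dot_norm bT adj ss px) _.
  rewrite ler_wpM2r ?rnorm_ge0//; apply: le_trans (hC _) _.
  apply: ler_pM => //; first by rewrite lerDl.
  by rewrite lef_pV2 ?posrE ?ltr0n// ler_nat.
apply: (@ell_inftyP _ _ (C * 2)) => N.
rewrite /trace_means -fmorphV rnormM rnorm_real.
rewrite ger0_norm ?invr_ge0 ?(ltW (lnS2_gt0 _ _))// ler_pdivrMr ?lnS2_gt0//.
rewrite trace_on_mkseq; apply: le_trans (rnorm_sum _ _) _.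
rewrite -mulrA; apply: le_trans (_ : C * \sum_(k < N.+1) k.+1%:R^-1 <= _); last first.
  by rewrite ler_wpM2l// harmonic_le.
rewrite mulr_sumr; apply: ler_sum => k _; apply: le_trans (hC k).
apply: le_trans (dot_le dot_norm _ _) _.
by rewrite (orthonormal_norm dot_norm _ of_) mulr1 (singular_norm dot_norm adj ss).
Qed.

End WeakTraceClass.

(** * Stability of compact operators *)

Section Compactness.
Variables (R : realType) (H : completeNormedModType R[i]).
Implicit Types (x y z : H) (S T : H -> H).

Lemma compact_op_image T (K : set H) : linear T -> compact K ->
  (forall x, rnorm x <= 1 -> K (T x)) -> compact_op T.
Proof.
move=> lT cK h; split=> //; exists K; last first.
  by split=> //; apply: compact_closed => //; exact: norm_hausdorff.
by move=> _ [x /= x1 <-]; apply: h; rewrite rnormE lecR in x1.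
Qed.

Lemma compact_opP T : compact_op T -> linear T /\
  exists2 K : set H, compact K & forall x, rnorm x <= 1 -> K (T x).
Proof.
move=> [lT [K TK [cK _]]]; split=> //; exists K => // x x1.
by apply: TK; exists x => //=; rewrite rnormE lecR.
Qed.

Lemma bounded_continuous T : bounded_op T -> continuous T.
Proof.
move=> /bounded_opP[lT [M M0 hM]] x; apply/cvgrPdist_lt => e e0.
have eE : e = (complex.Re e)%:C by rewrite RRe_real// gtr0_real.
have e0' : 0 < complex.Re e by rewrite -(ltcR 0) -eE.
have M1 : 0 < M + 1 by rewrite ltr_pwDr.
have d0 : 0 < (complex.Re e / (M + 1))%:C :> R[i] by rewrite (ltcR 0) divr_gt0.
apply: filterS (nbhsx_ballx x _ d0) => y.
rewrite -ball_normE/= !rnormE eE !ltcR ltr_pdivlMr// => h.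
rewrite -(linearfB lT); apply: le_lt_trans h; apply: le_trans (hM _) _.
by rewrite mulrC ler_wpM2l ?rnorm_ge0// lerDl.
Qed.

Lemma compact_op_comp S T X : bounded_op S -> compact_op T -> bounded_op X ->
  compact_op (fun x => S (T (X x))).
Proof.
move=> bS /compact_opP[lT [K cK hK]] bX.
have [lS [N N0 hS]] := bounded_opP bS; have [lX [M M0 hX]] := bounded_opP bX.
have M1 : M + 1 != 0 by rewrite gt_eqF// ltr_pwDr.
(* [T] is controlled on the unit ball only, so [X x] is shrunk by [M + 1], nonzero even if [M = 0],
   and [h] undoes the scaling. *)
pose h z := S ((M + 1)%:C *: z).
have bh : bounded_op h.
  apply: (@bounded_opI _ _ _ (N * (M + 1))) => [a x y|x].
    by rewrite /h scalerDr scalerA mulrC -scalerA lS.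
  apply: le_trans (hS _) _; rewrite rnormZ rnorm_real ger0_norm ?addr_ge0//.
  by rewrite mulrA.
apply: (@compact_op_image _ (h @` K)).
- by move=> a x y /=; rewrite lX lT lS.
- apply: continuous_compact => //; apply: continuous_subspaceT.
  exact: bounded_continuous.
- move=> x x1; exists (T ((M + 1)^-1%:C *: X x)); last first.
    by rewrite /h (linearfZ lT) scalerA -rmorphM/= mulfV// scale1r.
  apply: hK; rewrite rnormZ rnorm_real ger0_norm ?invr_ge0 ?addr_ge0//.
  rewrite mulrC ler_pdivrMr ?mul1r ?ltr_pwDr//; apply: le_trans (hX x) _.
  rewrite -[leRHS]mulr1; apply: ler_pM => //; [exact: rnorm_ge0|by rewrite lerDl].
Qed.

Lemma compact_op_lin (a : R[i]) S T : compact_op S -> compact_op T ->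
  compact_op (fun x => a *: S x + T x).
Proof.
move=> /compact_opP[lS [K cK hK]] /compact_opP[lT [L cL hL]].
apply: (@compact_op_image _ ((fun z : H * H => a *: z.1 + z.2) @` (K `*` L))).
- by move=> b x y /=; rewrite lS lT scalerDr addrACA scalerDr !scalerA mulrC.
- apply: continuous_compact; last exact: compact_setX.
  apply: continuous_subspaceT => z.
  by apply: cvgD; [apply: cvgZr; exact: cvg_fst|exact: cvg_snd].
- by move=> x x1; exists (S x, T x) => //; split; [exact: hK|exact: hL].
Qed.

End Compactness.

(** * The Dixmier trace *)

Section DixmierTrace.
Variables (R : realType) (H : completeNormedModType R[i]).
Variable dot : {dot H for Num.conj}.
Hypothesis dot_norm : dot_induces_norm dot.
Variable e : nat -> H.
Hypothesis e_basis : orthonormal_basis dot e.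
Implicit Types (x y z : H) (S T X : H -> H).

Lemma approximates_join S T (u v : nat -> seq H) :
  approximates dot S u -> approximates dot T v ->
  exists w, [/\ approximates dot S w, approximates dot T w &
    forall a : R[i], approximates dot (fun x => a *: S x + T x) w].
Proof.
move=> [ou [C C0 hu]] [ov [D D0 hv]].
have /choice[v' hv'] : forall N, exists v', [/\ orthonormal_list dot (u N ++ v'),
    (size v' <= size (v N))%N &
    forall x, perp dot x (u N ++ v') <-> perp dot x (u N) /\ perp dot x (v N)].
  by move=> N; exact: gram_schmidt.
pose w N := u N ++ v' N; exists w.
have ow N : orthonormal_list dot (w N) by have [] := hv' N.
have sw N : (size (w N))%:R <= (C + D) * N.+1%:R :> R.
  have [_ s _] := hv' N; have [su _] := hu N; have [sv _] := hv N.
  rewrite size_cat natrD mulrDl; apply: lerD => //.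
  by apply: le_trans sv; rewrite ler_nat.
have pw N x : perp dot x (w N) ->
    rnorm (S x) <= C / N.+1%:R * rnorm x /\ rnorm (T x) <= D / N.+1%:R * rnorm x.
  have [_ _ p] := hv' N; move=> /p[pu pv]; have [_ hu'] := hu N.
  by have [_ hv''] := hv N; split; [exact: hu'|exact: hv''].
(* [C + D] accounts for the size of [w N]; [E] leaves room for the factor [rnorm a] in the
   combination. *)
have weaken X (E F : R) : 0 <= E -> C + D + E = F ->
    (forall N x, perp dot x (w N) -> rnorm (X x) <= F / N.+1%:R * rnorm x) ->
    approximates dot X w.
  move=> E0 FE hX; split=> //; exists F; first by rewrite -FE !addr_ge0.
  move=> N; split; last exact: hX.
  by apply: le_trans (sw N) _; rewrite ler_wpM2r// -FE lerDl.
have mono N x (A B : R) : A <= B ->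
    A / N.+1%:R * rnorm x <= B / N.+1%:R * rnorm x.
  by move=> AB; rewrite ler_wpM2r ?rnorm_ge0// ler_wpM2r ?invr_ge0.
split=> [| |a].
- apply: (weaken _ 0 (C + D)) => // [|N x /pw[h _]]; first by rewrite addr0.
  by apply: le_trans h _; apply: mono; rewrite lerDl.
- apply: (weaken _ 0 (C + D)) => // [|N x /pw[_ h]]; first by rewrite addr0.
  by apply: le_trans h _; apply: mono; rewrite lerDr.
- apply: (weaken _ (rnorm a * C) (C + D + rnorm a * C)) => // [|N x /pw[h1 h2]].
    by rewrite mulr_ge0 ?rnorm_ge0.
  apply: le_trans (rnormD _ _) _; rewrite rnormZ.
  apply: (@le_trans _ _ ((rnorm a * C + D) / N.+1%:R * rnorm x)); last first.
    by apply: mono; rewrite (addrC (C + D)) lerD2l lerDr.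
  rewrite !mulrDl; apply: lerD => //.
  by rewrite -!mulrA ler_wpM2l ?rnorm_ge0// mulrA.
Qed.

(** Converse of [weak_schatten1_approx]: given [k], take [N] about [k / C], so that [u N] has at
    most [k] vectors and minimax gives [mu k <= C / N.+1%:R]. *)
Lemma approximates_singular_values T (u : nat -> seq H) : compact_op T ->
  approximates dot T u ->
  exists C : R, forall k, singular_values dot T k <= C * (1 + k%:R) `^ (- 1^-1).
Proof.
move=> cT [ou [C C0 hu]].
have [Tad [f [adj ss]]] := singular_valuesP dot_norm e_basis cT.
have bT := compact_bounded cT.
set mu := singular_values dot T in ss *; have [dmu mu0 _ _ _] := ss.
pose c := (Num.truncn C).+1.
have Cc : C <= c%:R by rewrite ltW// truncnS_gt.
have c0 : 0 <= c%:R :> R by [].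
(* The first term covers [k < c], where no such [N] exists; the second comes from
   [k.+1 <= 2 * c * N.+1] and [C <= c]. *)
exists (mu 0 * c%:R + 2 * (c%:R * c%:R)) => k.
rewrite nat1r invr1 powR_inv1// ler_pdivlMr ?ltr0n//.
have [kc|ck] := ltnP k c.
  apply: (@le_trans _ _ (mu 0 * c%:R)); last by rewrite lerDl !mulr_ge0.
  by apply: ler_pM => //; [exact: dmu|rewrite ler_nat].
pose N := (k %/ c).-1.
have NE : N.+1 = (k %/ c)%N by rewrite prednK// divn_gt0.
have [su pu] := hu N.
have sk : (size (u N) <= k)%N.
  rewrite -(ler_nat R); apply: le_trans su _.
  apply: (@le_trans _ _ (c%:R * N.+1%:R)); first by rewrite ler_wpM2r.
  by rewrite -natrM ler_nat NE mulnC leq_trunc_div.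
have mk := singular_minimax dot_norm bT adj ss sk pu.
have k1 : k.+1%:R <= 2 * (c%:R * N.+1%:R) :> R.
  rewrite -!natrM ler_nat; apply: leq_trans (ltn_ceil k (_ : 0 < c)%N) _; first by [].
  rewrite -NE mulnC mul2n -addnn -mulnDr leq_mul2l; apply/orP; right.
  by rewrite addnS ltnS leq_addr.
apply: (@le_trans _ _ (2 * (c%:R * c%:R))); last by rewrite lerDr mulr_ge0.
apply: (@le_trans _ _ (C / N.+1%:R * (2 * (c%:R * N.+1%:R)))).
  by apply: ler_pM.
have n0 : N.+1%:R != 0 :> R by rewrite pnatr_eq0.
have -> : C / N.+1%:R * (2 * (c%:R * N.+1%:R)) = 2 * (C * c%:R).
  by move: n0; move: (N.+1%:R) => n n0; field.
by rewrite ler_pM2l// ler_wpM2r.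
Qed.

Lemma weak_schatten1_lin (a : R[i]) S T :
  weak_schatten dot 1 S -> weak_schatten dot 1 T ->
  weak_schatten dot 1 (fun x => a *: S x + T x).
Proof.
move=> wS wT; have [cS _] := wS; have [cT _] := wT.
have [? [? [aS sS]]] := singular_valuesP dot_norm e_basis cS.
have [? [? [aT sT]]] := singular_valuesP dot_norm e_basis cT.
have [hS _] := weak_schatten1_approx dot_norm wS aS sS.
have [hT _] := weak_schatten1_approx dot_norm wT aT sT.
have [w [_ _ /(_ a) hw]] := approximates_join hS hT.
have cST := compact_op_lin a cS cT.
by split=> //; exact: approximates_singular_values hw.
Qed.

(** Polarisation: the sesquilinear form [D] vanishes on the diagonal, and x + y and x + iy give D x
    y = - D y x and D x y = D y x. *)
Lemma positive_adjoint T : positive_op dot T -> is_adjoint dot T T.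
Proof.
move=> [bT pT]; have [lT _] := bT; split=> //.
pose D x y := dot (T x) y - dot x (T y).
have D0 x : D x x = 0.
  apply/eqP; rewrite subr_eq0 (dotC dot (T x)); apply/eqP/esym/CrealP.
  exact: ger0_real.
have DD a x y : D (x + a *: y) (x + a *: y) =
    D x x + a * Num.conj a * D y y + (Num.conj a * D x y + a * D y x).
  rewrite /D (linearfD lT) (linearfZ lT) !dotDl !dotDr !dotZl !dotZr; ring.
move=> x y; apply/eqP; rewrite -subr_eq0 -/(D x y); apply/eqP.
have h1 := DD 1 x y; have h2 := DD 'i%C x y.
move: h1 h2; rewrite !D0 !mulr0 !add0r conjC1 !mul1r complexiE conjCi mulNr.
move=> /esym/eqP; rewrite addr_eq0 => /eqP -> /esym/eqP.
rewrite mulrN opprK -mulr2n -mulr_natl mulf_eq0 pnatr_eq0/= mulf_eq0.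
by rewrite (negbTE (neq0Ci _))/= => /eqP ->; rewrite oppr0.
Qed.

(** As T^2 f = mu^2 f, the vector w = T f - mu f satisfies T w = - mu w, which positivity allows
    only for w = 0. Hence the trace over singular vectors sums the singular values. *)
Lemma positive_eigen T Tad f mu : positive_op dot T ->
  is_adjoint dot T Tad -> singular_system dot T Tad f mu ->
  forall k, T (f k) = (mu k)%:C *: f k.
Proof.
move=> posT adj ss k; have [bT pT] := posT; have [lT _] := bT.
have [_ sT] := positive_adjoint posT; have [_ hT] := adj.
have [_ mu0 of_ ef _] := ss.
have TT : T (T (f k)) = (mu k ^+ 2)%:C *: f k.
  by rewrite -ef; apply: (dot_inj dot_norm) => x; rewrite -sT -hT.
have [m0|m0] := eqVneq (mu k) 0.
  rewrite m0 scale0r; apply: rnorm_eq0.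
  by rewrite (singular_norm dot_norm adj ss).
have mp : 0 < mu k by rewrite lt_neqAle eq_sym m0 mu0.
apply/eqP; rewrite -subr_eq0; set w := _ - _.
have Tw : T w = - (mu k)%:C *: w.
  rewrite /w (linearfB lT) (linearfZ lT) TT scalerBr scaleNr scalerA.
  by rewrite mulNr scaleNr opprK -rmorphM/= -expr2 addrC.
have := pT w; rewrite Tw dotZl (dotxx dot_norm) -rmorphN -rmorphM/= ler0c.
rewrite mulNr oppr_ge0 pmulr_rle0// => w0.
apply/eqP/rnorm_eq0/eqP; rewrite -sqrf_eq0.
by rewrite eq_le w0 sqr_ge0.
Qed.

Section Omega.
Variable omega : (nat -> R[i]) -> R[i].
Hypothesis omega_singular : singular_state omega.

Lemma trace_means_diff X (u v : nat -> seq H) (K : R) N :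
  rnorm (trace_on dot X (u N) - trace_on dot X (v N)) <= K ->
  rnorm (trace_means dot X u N - trace_means dot X v N) <= K / ln N.+2%:R.
Proof.
move=> h; rewrite /trace_means -mulrBl -fmorphV rnormM rnorm_real.
rewrite ger0_norm ?invr_ge0 ?(ltW (lnS2_gt0 _ _))//.
by rewrite ler_wpM2r// invr_ge0 (ltW (lnS2_gt0 _ _)).
Qed.

Lemma omega_trace_means X (u v : nat -> seq H) : linear X ->
  approximates dot X u -> approximates dot X v ->
  ell_infty (trace_means dot X u) ->
  ell_infty (trace_means dot X v) /\
  omega (trace_means dot X v) = omega (trace_means dot X u).
Proof.
move=> lX hu hv bu; have [K hK] := approximates_diff dot_norm lX hu hv.
by apply: (@omega_eq _ _ omega_singular _ _ K) => // N; exact: trace_means_diff.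
Qed.

(** The family is left open so that the value can be computed on whichever one suits all operators
    at hand. *)
Definition approximate_trace X : R[i] :=
  xget 0 [set t | exists u, [/\ approximates dot X u,
    ell_infty (trace_means dot X u) & t = omega (trace_means dot X u)]].

Lemma approximate_traceE X u : linear X -> approximates dot X u ->
  ell_infty (trace_means dot X u) ->
  approximate_trace X = omega (trace_means dot X u).
Proof.
move=> lX hu bu; rewrite /approximate_trace.
have [v [hv bv ->]] := @xgetPex _ 0 [set t | exists u, [/\ approximates dot X u,
    ell_infty (trace_means dot X u) & t = omega (trace_means dot X u)]]
  (ex_intro _ _ (ex_intro _ u (And3 hu bu erefl))).
by have [] := omega_trace_means lX hu hv bu.
Qed.

(** Reconciles the denominator [ln N] of the Dixmier trace with [ln N.+2]. For N >= 2 one has N + 2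
    <= N^2, so a N / ln N <= 2 K, while ln (N+2) - ln N <= 2/N <= 1. *)
Lemma log_means_eq (a : nat -> R) (K : R) : 0 <= K ->
  (forall N, 0 <= a N <= K * ln N.+2%:R) ->
  omega (fun N => (a N / ln N%:R)%:C) = omega (fun N => (a N / ln N.+2%:R)%:C).
Proof.
move=> K0 ha.
(* [2 * K] serves N >= 2; [K * ln 3] serves N = 0 and 1, where [ln N = 0] makes the quotient 0. *)
apply: (proj2 (@omega_eq _ _ omega_singular (fun N => (a N / ln N.+2%:R)%:C)
  (fun N => (a N / ln N%:R)%:C) (2 * K + K * ln 3) _ _)).
  apply: (@ell_inftyP _ _ K) => N; have /andP[a0 aK] := ha N.
  rewrite rnorm_real ger0_norm ?divr_ge0 ?(ltW (lnS2_gt0 _ _))//.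
  by rewrite ler_pdivrMr ?lnS2_gt0.
move=> N; have /andP[a0 aK] := ha N; have l0 := lnS2_gt0 R N.
rewrite -rmorphB/= rnorm_real.
have ln3 : 0 <= ln 3 :> R by rewrite ln_ge0// ler1n.
rewrite ler_pdivlMr// -(ger0_norm (ltW l0)) -normrM (ger0_norm (ltW l0)).
rewrite mulrBl mulfVK ?gt_eqF//.
have [N2|N2] := ltnP N 2.
  have -> : ln N%:R = 0 :> R.
    by case: N N2 {ha a0 aK l0} => [|[|]]//= _; rewrite ?ln1// ln0.
  rewrite invr0 mulr0 mul0r subr0 ger0_norm//; apply: le_trans aK _.
  apply: (@le_trans _ _ (K * ln 3)); last by rewrite lerDr mulr_ge0.
  by rewrite ler_wpM2l// ler_ln ?posrE ?ltr0n// ler_nat.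
have lN : 0 < ln N%:R :> R by rewrite ln_gt0// ltr1n.
have lNN : ln N%:R <= ln N.+2%:R :> R.
  by rewrite ler_ln ?posrE ?ltr0n// ?ler_nat; [do 2!apply: leqW|exact: ltnW].
have ratio : ln N.+2%:R <= 2 * ln N%:R :> R.
  rewrite mulr_natl -lnXn ?ltr0n ?(ltnW N2)//.
  rewrite ler_ln ?posrE ?exprn_gt0 ?ltr0n ?(ltnW N2)// -natrX ler_nat.
  case: N N2 {ha a0 aK l0 lN lNN} => [|[|n]]//= _.
  rewrite -mulnn; apply: (@leq_trans (2 * n.+2)); last by rewrite leq_mul2r orbT.
  by rewrite mul2n -addnn !addnS !ltnS leq_addr.
have delta : ln N.+2%:R - ln N%:R <= 1 :> R.
  have Np : 0 < N%:R :> R by rewrite ltr0n ltnW.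
  rewrite -ln_div ?posrE ?ltr0n ?(ltnW N2)//.
  have -> : N.+2%:R / N%:R = 1 + 2 / N%:R :> R.
    by rewrite -addn2 natrD mulrDl mulfV// gt_eqF.
  apply: le_trans (le_ln1Dx _) _; last by rewrite ler_pdivrMr// mul1r ler_nat.
  by apply: lt_le_trans (_ : 0 <= _); rewrite ?ltrN10// divr_ge0// ltW.
have -> : a N - a N / ln N%:R * ln N.+2%:R
    = - (a N / ln N%:R * (ln N.+2%:R - ln N%:R)).
  by rewrite mulrBr mulfVK ?gt_eqF// opprB.
rewrite normrN ger0_norm; last by rewrite mulr_ge0 ?divr_ge0 ?subr_ge0// ltW.
apply: (@le_trans _ _ (2 * K)); last by rewrite lerDl mulr_ge0.
rewrite -[leRHS]mulr1; apply: ler_pM => //.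
- by rewrite divr_ge0// ltW.
- by rewrite subr_ge0.
- rewrite ler_pdivrMr//; apply: le_trans aK _.
  by rewrite (mulrC 2) -mulrA ler_wpM2l.
Qed.

Lemma approximate_trace_is_dixmier : is_dixmier_trace dot omega approximate_trace.
Proof.
split=> [a S T wS wT|G wG posG].
  have [cS _] := wS; have [cT _] := wT.
  have [lS _] := cS; have [lT _] := cT.
  have [Sad [f [aS sS]]] := singular_valuesP dot_norm e_basis cS.
  have [Tad [g [aT sT]]] := singular_valuesP dot_norm e_basis cT.
  have [hS bS] := weak_schatten1_approx dot_norm wS aS sS.
  have [hT bT] := weak_schatten1_approx dot_norm wT aT sT.
  (* All three traces are evaluated on the common family [w], where linearity is literal. *)
  have [w [hSw hTw /(_ a) hw]] := approximates_join hS hT.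
  have [bSw _] := omega_trace_means lS hS hSw bS.
  have [bTw _] := omega_trace_means lT hT hTw bT.
  have lST := linear_lin a lS lT.
  have E : trace_means dot (fun x => a *: S x + T x) w =
      (fun N => a * trace_means dot S w N + trace_means dot T w N).
    apply/funext => N; rewrite /trace_means mulrA -mulrDl; congr (_ / _).
    rewrite /trace_on mulr_sumr -big_split/=; apply: eq_bigr => y _.
    by rewrite dotDl dotZl.
  have [lin _ _ _] := omega_singular.
  rewrite (approximate_traceE lS hSw bSw) (approximate_traceE lT hTw bTw).
  rewrite (approximate_traceE lST hw) E ?lin//.
  have [M hM] := bSw; have [M' hM'] := bTw.
  apply: (@ell_inftyP _ _ (rnorm a * M + M')) => n.
  apply: le_trans (rnormD _ _) _; rewrite rnormM; apply: lerD.
    by rewrite ler_wpM2l ?rnorm_ge0// -lecR -rnormE.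
  by rewrite -lecR -rnormE.
have [cG _] := wG; have [lG _] := cG.
have [Gad [f [aG sG]]] := singular_valuesP dot_norm e_basis cG.
have [hG bG] := weak_schatten1_approx dot_norm wG aG sG.
rewrite (approximate_traceE lG hG bG).
have [C C0 hC] := weak_schatten1_bound wG.
have [_ mu0 of_ _ _] := sG.
rewrite (@log_means_eq (fun N => \sum_(k < N.+1) singular_values dot G k) (C * 2)).
- congr omega; apply/funext => N.
  rewrite /trace_means trace_on_mkseq rmorphM/= fmorphV rmorph_sum/=.
  congr (_ / _); apply: eq_bigr => k _.
  rewrite (positive_eigen posG aG sG) dotZl (dotxx dot_norm).
  by rewrite (orthonormal_norm dot_norm _ of_) expr1n mulr1.
- by rewrite mulr_ge0.
- move=> N; rewrite sumr_ge0//=.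
  rewrite -mulrA; apply: le_trans (_ : C * \sum_(k < N.+1) k.+1%:R^-1 <= _); last first.
    by rewrite ler_wpM2l// harmonic_le.
  by rewrite mulr_sumr; apply: ler_sum => k _; exact: hC.
Qed.

End Omega.

End DixmierTrace.

(** * Polar decomposition and uniqueness of the Dixmier trace *)

Section Uniqueness.
Variables (R : realType) (H : completeNormedModType R[i]).
Variable dot : {dot H for Num.conj}.
Hypothesis dot_norm : dot_induces_norm dot.
Variable e : nat -> H.
Hypothesis e_basis : orthonormal_basis dot e.
Implicit Types (x y z : H) (S T X : H -> H).

Section PolarDecomposition.
Variables (T Tad : H -> H) (f : nat -> H) (mu : nat -> R).
Hypotheses (bT : bounded_op T) (adj : is_adjoint dot T Tad).
Hypothesis ss : singular_system dot T Tad f mu.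

Let g k := (mu k)^-1%:C *: T (f k).

Lemma singular_image k : T (f k) = (mu k)%:C *: g k.
Proof.
rewrite /g scalerA -rmorphM/=.
have [m0|m0] := eqVneq (mu k) 0; last by rewrite mulfV// scale1r.
rewrite m0 mul0r scale0r; apply: rnorm_eq0.
by rewrite (singular_norm dot_norm adj ss).
Qed.

Lemma singular_image_sub : suborthonormal dot g.
Proof.
have [_ mu0 _ _ _] := ss; split=> [i j /negbTE ij|i].
  by rewrite /g dotZl dotZr (singular_dot adj ss) ij mul0r !mulr0.
rewrite rnormZ rnorm_real (singular_norm dot_norm adj ss).
rewrite ger0_norm ?invr_ge0//.
by have [->|m0] := eqVneq (mu i) 0; rewrite ?mulr0// mulVf.
Qed.

(* [W] is the partial isometry and [Wad \o T] the absolute value of [T]. *)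
Lemma polar_decomposition : exists W Wad, [/\ bounded_op W,
  is_adjoint dot W Wad,
  forall k, W (f k) = g k,
  forall x, 0 <= dot (Wad (T x)) x &
  forall x, W (Wad (T x)) = T x].
Proof.
have [_ mu0 of_ _ _] := ss; have sg := singular_image_sub.
have /choice[W hW] : forall x, exists y,
    converges (fun n => \sum_(k < n) dot x (f k) *: g k) y.
  move=> x; apply: (@series_converges _ _ _ dot_norm g (fun k => dot x (f k))
    (rnorm x ^+ 2)) => // n; exact: bessel_seq.
have bW : bounded_op W.
  apply: (@bounded_opI _ _ _ 1) => [a x y|x].
    apply: converges_unique (hW _) _.
    apply: eq_converges (converges_lin a (hW x) (hW y)) => n /=.
    rewrite scaler_sumr -big_split/=; apply: eq_bigr => k _.
    by rewrite scalerA -scalerDl dotDl dotZl.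
  apply: (converges_le (n0 := 0) (hW x)) => n _.
  rewrite mul1r -(@ler_pXn2r _ 2)// ?nnegrE ?rnorm_ge0//.
  rewrite -(big_mkord xpredT (fun k => dot x (f k) *: g k)).
  apply: le_trans (suborthonormal_sum dot_norm _ _ _ sg) _.
  by rewrite big_mkord; exact: bessel_seq.
have Wf k : W (f k) = g k.
  apply: converges_unique (hW _) _.
  apply: (@tail_converges _ _ (fun=> g k) _ _ k.+1) => [n kn|].
    rewrite (bigD1 (Ordinal kn))//= of_ eqxx scale1r big1 ?addr0//.
    move=> i ik; rewrite of_ eq_sym; case: eqP => [e0|]; last by rewrite scale0r.
    by move: ik; rewrite -val_eqE/= e0 eqxx.
  exact: converges_const.
have [Wad adjW] := adjoint_exists dot_norm e_basis bW.
have [bWad hWad] := adjW; have [lWad _] := bWad; have [lW _] := bW.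
(* The factor [mu k] is kept because [Wad (g k) = f k] can fail when [mu k = 0], where [g k = 0]. *)
have Wadg k : (mu k)%:C *: Wad (g k) = (mu k)%:C *: f k.
  have [m0|m0] := eqVneq (mu k) 0; first by rewrite m0 !scale0r.
  congr (_ *: _); apply: (dot_inj dot_norm) => x; rewrite -hWad.
  apply: converges_unique (converges_dotl dot_norm (g k) (hW x)) _.
  apply: (@tail_converges _ _ (fun=> dot x (f k)) _ _ k.+1) => [n kn|].
    rewrite dot_suml (bigD1 (Ordinal kn))//= dotZl (dotxx dot_norm).
    rewrite rnormZ (singular_norm dot_norm adj ss) rnorm_real.
    rewrite ger0_norm ?invr_ge0// mulVf// expr1n mulr1 big1 ?addr0//.
    by have [og _] := sg; move=> i ik; rewrite dotZl og ?mulr0.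
  exact: converges_const.
have PT k : Wad (T (f k)) = (mu k)%:C *: f k.
  by rewrite singular_image (linearfZ lWad) Wadg.
have Pexp x : converges (fun n => \sum_(k < n) (dot x (f k) * (mu k)%:C) *: f k)
    (Wad (T x)).
  apply: eq_converges (converges_bounded bWad (singular_expansion dot_norm bT adj ss x)).
  move=> n /=; rewrite (linearf_sum lWad); apply: eq_bigr => k _.
  by rewrite (linearfZ lWad) PT scalerA.
exists W, Wad; split=> // x.
  apply: converges_ge0 (converges_dotl dot_norm x (Pexp x)) _ => n.
  rewrite dot_suml sumr_ge0// => k _.
  rewrite dotZl mulrAC (dotC dot x) mul_conjE -rmorphM/= ler0c.
  by rewrite mulr_ge0 ?sqr_ge0.
apply: converges_unique (converges_bounded bW (Pexp x)) _.
apply: eq_converges (singular_expansion dot_norm bT adj ss x) => n /=.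
rewrite (linearf_sum lW); apply: eq_bigr => k _.
by rewrite (linearfZ lW) Wf -scalerA -singular_image.
Qed.

End PolarDecomposition.

(* With [W] and [P = Wad \o G] from the polar decomposition, [G = W P] and
   [4 W P = \sum_c c (W + c) P (W + c)^*] over the fourth roots of unity [c]. *)
Lemma weak_schatten1_positive_span G : weak_schatten dot 1 G ->
  exists A : R[i] -> H -> H,
    (forall c, weak_schatten dot 1 (A c) /\ positive_op dot (A c)) /\
    forall x, G x = 4^-1 *: (1 *: A 1 x + ('i *: A 'i x +
      (- 1 *: A (- 1) x + - 'i *: A (- 'i) x))).
Proof.
move=> wG; have [cG _] := wG; have bG := compact_bounded cG.
have [lG _] := bG.
have [Gad [f [adj ss]]] := singular_valuesP dot_norm e_basis cG.
set mu := singular_values dot G in ss.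
have [dmu mu0 of_ _ _] := ss.
have [W [Wad [bW adjW Wf P0 WP]]] := polar_decomposition bG adj ss.
pose g k := (mu k)^-1%:C *: G (f k); have {}Wf k : W (f k) = g k := Wf k.
have [bWad hW] := adjW; have [lW _] := bW; have [lWad _] := bWad.
pose Y (c : R[i]) x := c *: x + W x.
pose Yad (c : R[i]) x := Num.conj c *: x + Wad x.
have bid : bounded_op (fun x : H => x).
  by apply: (@bounded_opI _ _ _ 1) => // x; rewrite mul1r.
have bY c : bounded_op (Y c) by exact: bounded_op_lin.
have bYad c : bounded_op (Yad c) by exact: bounded_op_lin.
have hY c x y : dot (Y c x) y = dot x (Yad c y).
  by rewrite dotDl dotDr dotZl dotZr conjCK hW.
pose A c x := Y c (Wad (G (Yad c x))).
exists A; split=> [c|x].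
  have cA : compact_op (A c).
    by apply: (@compact_op_comp _ _ (fun x => Y c (Wad x))) => //;
       exact: bounded_op_comp.
  have bA := compact_bounded cA.
  split; last by split=> // x; rewrite /A hY.
  split=> //; have [C C0 hC] := weak_schatten1_bound wG.
  have [lYad [M M0 hM]] := bounded_opP (bYad c).
  have [lYW [K K0 hK]] := bounded_opP (bounded_op_comp (bY c) bWad).
  (* A family adapted to [A c]: as [Y c (f k) = c *: f k + g k], a vector orthogonal to the [f k]
     and [g k] is sent by [Yad c] to the complement of the [f k], where [G] is small. *)
  have /choice[v hv] : forall N, exists v, [/\ orthonormal_list dot (mkseq f N.+1 ++ v),
      (size v <= size (mkseq g N.+1))%N &
      forall x, perp dot x (mkseq f N.+1 ++ v) <->
        perp dot x (mkseq f N.+1) /\ perp dot x (mkseq g N.+1)].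
    by move=> N; apply: gram_schmidt => //; exact: orthonormal_mkseq.
  apply: (@approximates_singular_values _ _ _ dot_norm _ e_basis _
    (fun N => mkseq f N.+1 ++ v N)) => //.
  split=> [N|]; first by have [] := hv N.
  (* 2 bounds the size; [K], [C] and [M] come from the three factors of [A c]. *)
  exists (K * C * M + 2); first by rewrite addr_ge0 ?mulr_ge0.
  move=> N; have [_ sv pv] := hv N; split.
    apply: (@le_trans _ _ (2 * N.+1%:R)).
      rewrite size_cat size_mkseq -natrM ler_nat mul2n -addnn leq_add2l.
      by apply: leq_trans sv _; rewrite size_mkseq.
    by rewrite ler_wpM2r// lerDr !mulr_ge0.
  move=> x /pv[pf pg].
  have py : perp dot (Yad c x) (mkseq f N.+1).
    move=> _ /mapP[k kN ->]; apply: (@dot_eq0C _ _ dot).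
    rewrite -hY dotDl dotZl Wf (@dot_eq0C _ _ dot x (f k)); last first.
      by apply: pf; apply/mapP; exists k.
    rewrite (@dot_eq0C _ _ dot x (g k)) ?mulr0 ?addr0//.
    by apply: pg; apply/mapP; exists k.
  apply: le_trans (hK _) _.
  apply: (@le_trans _ _ (K * (C / N.+1%:R * (M * rnorm x)))).
    rewrite ler_wpM2l//; apply: le_trans (singular_tail dot_norm bG adj ss py) _.
    apply: ler_pM => //; first exact: rnorm_ge0.
    apply: le_trans (hC _) _; rewrite ler_wpM2l// lef_pV2 ?posrE ?ltr0n//.
    by rewrite ler_nat.
  have -> : K * (C / N.+1%:R * (M * rnorm x)) = K * C * M / N.+1%:R * rnorm x.
    by ring.
  by rewrite ler_wpM2r ?rnorm_ge0// ler_wpM2r ?invr_ge0// lerDl.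
have AE c : A c x = (c * Num.conj c) *: Wad (G x) + c *: Wad (G (Wad x))
    + (Num.conj c *: G x + W (Wad (G (Wad x)))).
  rewrite /A /Y /Yad !(linearfD lG, linearfZ lG, linearfD lWad, linearfZ lWad).
  by rewrite (linearfD lW) (linearfZ lW) WP scalerDr scalerA.
rewrite !AE; set a := Wad (G x); set b := Wad _; set d := W b.
(* Formal coordinates in [a], [b], [G x], [d]. Over the fourth roots of unity the sums of c and of
   c^2 vanish, and that of c times its conjugate is 4. *)
pose L (p q r s : R[i]) := p *: a + q *: b + (r *: G x + s *: d).
have LD p q r s p' q' r' s' :
    L p q r s + L p' q' r' s' = L (p + p') (q + q') (r + r') (s + s').
  rewrite /L !scalerDl.
  by rewrite addrACA (addrACA (p *: a)) (addrACA (r *: G x)).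
have LZ c p q r s : c *: L p q r s = L (c * p) (c * q) (c * r) (c * s).
  by rewrite /L !scalerDr !scalerA.
have Lc c : (c * Num.conj c) *: a + c *: b + (Num.conj c *: G x + d)
    = L (c * Num.conj c) c (Num.conj c) 1 by rewrite /L scale1r.
rewrite !Lc !LZ !LD LZ !rmorphN/= conjC1 conjCi.
have ii : 'i * 'i = -1 :> R[i] by rewrite -expr2 sqrCi.
rewrite /L.
rewrite [X in X *: a](_ : _ = 0); last first.
  by rewrite !mulrN !mulNr !opprK !mulr1 ii; ring.
rewrite [X in X *: b](_ : _ = 0); last first.
  by rewrite !mulrN !mulNr !opprK !mulr1 ii; ring.
rewrite [X in X *: G x](_ : _ = 1); last first.
  by rewrite !mulrN !mulNr !opprK !mulr1 ii; field.
rewrite [X in X *: d](_ : _ = 0); last by ring.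
by rewrite !scale0r scale1r !add0r addr0.
Qed.

Lemma dixmier_trace_unique omega (tr1 tr2 : (H -> H) -> R[i]) G :
  is_dixmier_trace dot omega tr1 -> is_dixmier_trace dot omega tr2 ->
  weak_schatten dot 1 G -> tr1 G = tr2 G.
Proof.
move=> [lin1 pos1] [lin2 pos2] wG.
have [A [hA GE]] := weak_schatten1_positive_span wG.
have wA c : weak_schatten dot 1 (A c) by have [] := hA c.
pose agree S := weak_schatten dot 1 S /\ tr1 S = tr2 S.
have agreeA c : agree (A c).
  by split=> //; have [_ ?] := hA c; rewrite pos1 ?pos2.
have agree_lin a S T : agree S -> agree T -> agree (fun x => a *: S x + T x).
  move=> [wS eS] [wT eT]; split; first exact: (weak_schatten1_lin dot_norm e_basis).
  by rewrite lin1// lin2// eS eT.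
(* Closes the nested sum below, whose every layer must have the form [a *: S x + T x]. *)
have agree0 : agree (fun=> 0).
  rewrite (_ : (fun=> 0) = fun x => (-1) *: G x + G x).
    split; first exact: (weak_schatten1_lin dot_norm e_basis).
    by rewrite lin1// lin2// !mulN1r !addNr.
  by apply/funext => x; rewrite scaleN1r addNr.
suff [] : agree G by [].
have -> : G = fun x => 4^-1 *: (1 *: A 1 x + ('i *: A 'i x +
      (- 1 *: A (- 1) x + (- 'i *: A (- 'i) x + 0)))) + 0.
  by apply/funext => x; rewrite !addr0; exact: GE.
by do 5!(apply: (agree_lin) => //).
Qed.

End Uniqueness.

(** * Modulated operators *)

Section Modulated.
Variables (R : realType) (H : completeNormedModType R[i]).
Variable dot : {dot H for Num.conj}.
Hypothesis dot_norm : dot_induces_norm dot.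
Variable e : nat -> H.
Hypothesis e_basis : orthonormal_basis dot e.
Implicit Types (x y z : H) (G B V : H -> H).

(** The bound is the integral of x^(a-1) over [0, n]. With m = n + 1, the induction step reads a
    m^(a-1) <= m^a - n^a; division by m^a reduces it to an inequality in t = n/m. *)
Lemma sum_powR_le (a : R) n : 0 < a < 1 ->
  \sum_(k < n) k.+1%:R `^ (a - 1) <= a^-1 * n%:R `^ a.
Proof.
move=> /andP[a0 a1]; elim: n => [|n IH].
  by rewrite big_ord0 mulr_ge0 ?invr_ge0 ?powR_ge0// ltW.
rewrite big_ord_recr/=; apply: le_trans (lerD IH (lexx _)) _.
rewrite -lerBrDl -mulrBr ler_pdivlMl//.
set m : R := n.+1%:R; pose t : R := n%:R / m.
have m0 : 0 < m by rewrite ltr0n.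
have t0 : 0 <= t by rewrite divr_ge0.
have b0 : 0 < 1 - a by rewrite subr_gt0.
(* Bernoulli's inequality [t^a <= 1 - a (1 - t)], as a case of Young's. *)
have ta : t `^ a <= 1 - a * (1 - t).
  have := @conjugate_powR R (t `^ a) 1 a^-1 (1 - a)^-1.
  rewrite powR_ge0 ler01 !invr_gt0 a0 b0 !invrK powR1 -powRrM mulfV ?gt_eqF//.
  rewrite powRr1// mulr1 mul1r subrKC => /(_ isT isT isT isT erefl).
  by move/le_trans; apply; lra.
have ma : m `^ a = m * m `^ (a - 1) by rewrite mulr_powRB1// ltW.
have na : n%:R `^ a = t `^ a * m `^ a.
  by rewrite -powRM ?(ltW m0)// mulfVK// gt_eqF.
have tm : m * (1 - t) = 1.
  by rewrite mulrBr mulr1 /t mulrC mulfVK ?gt_eqF// /m -natr1 addrAC subrr add0r.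
rewrite na -{1}(mul1r (m `^ a)) -mulrBl ma.
apply: (@le_trans _ _ (a * (1 - t) * (m * m `^ (a - 1)))).
  by rewrite mulrA -(mulrA a) (mulrC _ m) tm mulr1.
rewrite ler_wpM2r ?mulr_ge0 ?powR_ge0 ?(ltW m0)//.
by move: ta; lra.
Qed.

(** Makes the results on singular systems, above all [singular_tail], available for the basis
    [e]. *)
Lemma eigenbasis_system V (lambda : nat -> R) : positive_op dot V ->
  (forall l, V (e l) = (lambda l)%:C *: e l) -> nonincreasing_seq lambda ->
  singular_system dot V V e lambda.
Proof.
move=> posV eV dl; have [bV pV] := posV; have [lV _] := bV.
have [oe be] := e_basis; split=> //.
- move=> k; have := pV (e k); rewrite eV dotZl (dotxx dot_norm).
  by rewrite (orthonormal_norm dot_norm _ oe) expr1n mulr1 ler0c.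
- by move=> k; rewrite !(eV, linearfZ lV) scalerA -rmorphM/= -expr2.
- move=> x xe; have -> : x = 0; last by rewrite !(linearf0 lV).
  apply: converges_unique (cvg_converges (be x)) _.
  apply: eq_converges (converges_const 0) => n.
  by rewrite big1// => l _; rewrite xe scale0r.
Qed.

(** The hypothesis on [V] bounds the chosen [singular_values]; minimax for the eigenbasis against
    the first [k] chosen singular vectors transfers the bound to [lambda]. *)
Lemma eigenvalue_le_singular V (lambda : nat -> R) k : positive_op dot V ->
  compact_op V -> (forall l, V (e l) = (lambda l)%:C *: e l) ->
  nonincreasing_seq lambda -> lambda k <= singular_values dot V k.
Proof.
move=> posV cV eV dl; have [bV _] := posV.
have [Vad [f [adj ss]]] := singular_valuesP dot_norm e_basis cV.
apply: (singular_minimax dot_norm bV (positive_adjoint posV)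
  (eigenbasis_system posV eV dl) (w := mkseq f k)); first by rewrite size_mkseq.
by move=> x; exact: singular_tail adj ss _ _.
Qed.

(* Splitting [V y] along the first [n] singular vectors [b k] of [B], the
   corresponding part of the trace is [\sum_k dot (V z_k) (b k)] where [z_k] is
   the projection of [B (b k)] on the span of [u]. *)
Lemma trace_on_factor_le B Bad V (b : nat -> H) (nu : nat -> R) (u : seq H)
    (n : nat) (d : R) :
  bounded_op B -> is_adjoint dot B Bad -> singular_system dot B Bad b nu ->
  linear V -> 0 <= d -> orthonormal_list dot u ->
  (forall c : H -> R[i], let z := \sum_(y <- u) c y *: y in
    rnorm (V z) <= d * rnorm z) ->
  rnorm (trace_on dot (fun x => B (V x)) u)
    <= d * \sum_(k < n) nu k + (size u)%:R * (nu n * d).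
Proof.
move=> bB adj ss lV d0 ou hV; have [lB _] := bB.
have [_ nu0 ob _ _] := ss; have on := orthonormal_mkseq n ob.
pose Q := proj dot (mkseq b n).
(* Taking for [c] the indicator of [y] isolates a single vector of [u]. *)
have VE y : y \in u -> rnorm (V y) <= d.
  move=> yu; have := hV (fun z => (z == y)%:R).
  rewrite /= (bigD1_seq y)//=; last by have [] := ou.
  rewrite eqxx scale1r big1 ?addr0; last first.
    by move=> z /negbTE ->; rewrite scale0r.
  by rewrite (orthonormal_list_norm dot_norm ou yu) mulr1.
have -> : trace_on dot (fun x => B (V x)) u =
    \sum_(k < n) dot (V (proj dot u (B (b k)))) (b k) +
    trace_on dot (fun x => B (V x - Q (V x))) u.
  rewrite /trace_on.
  under [X in X + _]eq_bigr => k _.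
    rewrite /proj (linearf_sum lV) dot_suml.
    under eq_bigr do rewrite (linearfZ lV) dotZl.
    over.
  rewrite exchange_big/= -big_split/=; apply: eq_bigr => y _.
  rewrite (linearfB lB) dotBl addrCA -[LHS]addr0; congr (_ + _).
  rewrite /Q /proj big_map (linearf_sum lB) dot_suml.
  rewrite -[X in iota _ X]subn0 big_mkord -sumrB big1// => k _.
  by rewrite (linearfZ lB) dotZl mulrC subrr.
apply: le_trans (rnormD _ _) _; apply: lerD.
  apply: le_trans (rnorm_sum _ _) _; rewrite mulr_sumr; apply: ler_sum => k _.
  apply: le_trans (dot_le dot_norm _ _) _.
  rewrite (orthonormal_norm dot_norm _ ob) mulr1.
  apply: le_trans (hV (dot (B (b k)))) _; rewrite ler_wpM2l//.
  rewrite -(singular_norm dot_norm adj ss); exact: rnorm_proj_le.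
apply: (trace_on_le dot_norm) => // y yu.
apply: le_trans (singular_tail dot_norm bB adj ss (perp_proj _ on)) _.
rewrite ler_wpM2l//; apply: le_trans (VE y yu).
rewrite -(@ler_pXn2r _ 2)// ?nnegrE ?rnorm_ge0//.
by rewrite [leRHS](proj_pythagoras dot_norm _ on) lerDl sqr_ge0.
Qed.

Lemma weakly_modulated_rest (p : R) V G (lambda : nat -> R) : 1 <= p ->
  weak_schatten dot p V -> positive_op dot V ->
  (forall l, V (e l) = (lambda l)%:C *: e l) -> nonincreasing_seq lambda ->
  weakly_modulated dot p V G ->
  exists K : R, forall N u, orthonormal_list dot (mkseq e N.+1 ++ u) ->
    (size u <= N.+1)%N -> rnorm (trace_on dot G u) <= K.
Proof.
move=> p1 wV posV eV dl [bG [B [bB dB BV]]].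
have [cV _] := wV; have [bV _] := posV; have [lV _] := bV.
have ss := eigenbasis_system posV eV dl; have [_ l0 oe _ _] := ss.
have [C C0 hC] := weak_schatten_bound wV.
(* Off [e 0], .., [e N] the eigenvalues start at [lambda N.+1]; the weaker bound at index [N] has
   the convenient base [N.+1]. *)
have hl N : lambda N.+1 <= C * N.+1%:R `^ (- p^-1).
  apply: le_trans (dl N N.+1 (leqnSn N)) _; apply: le_trans (hC N).
  exact: eigenvalue_le_singular.
have Vtail N z : perp dot z (mkseq e N.+1) ->
    rnorm (V z) <= lambda N.+1 * rnorm z.
  exact: singular_tail (positive_adjoint posV) ss _ _.
have GE : G = fun x => B (V x) by apply/funext => x; rewrite BV.
have p0 : 0 < p by apply: lt_le_trans p1.
(* For p = 1, [B] is merely bounded, but [V] already has norm O(1/N) on these vectors, so counting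
   them suffices. *)
move: dB; rewrite /weak_schatten_dual; case: eqVneq => [pE _|pn1 wB].
  have [lB [M M0 hM]] := bounded_opP bB.
  exists (M * C) => N u ou su; have ou' := orthonormal_list_catr ou.
  have pu y (yu : y \in u) := orthonormal_list_cat_perp ou yu.
  have n0 : 0 < N.+1%:R :> R by rewrite ltr0n.
  apply: (@le_trans _ _ ((size u)%:R * (M * (C / N.+1%:R)))).
    apply: (trace_on_le dot_norm) => // y yu; rewrite GE.
    apply: le_trans (hM _) _; rewrite ler_wpM2l//.
    apply: le_trans (Vtail N y (pu y yu)) _.
    rewrite (orthonormal_list_norm dot_norm ou' yu) mulr1.
    by apply: le_trans (hl N) _; rewrite pE invr1 powR_inv1.
  rewrite !mulrA ler_pdivrMr// -mulrA mulrC ler_wpM2l ?mulr_ge0//.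
  by rewrite ler_nat.
have [cB _] := wB; have [Bad [b [adjB sB]]] := singular_valuesP dot_norm e_basis cB.
have [D D0 hD] := weak_schatten_bound wB.
set nu := singular_values dot B in sB hD; have [dnu nu0 _ _ _] := sB.
have pinv : 0 < p^-1 < 1.
  by rewrite invr_gt0 p0 invf_lt1// lt_neqAle eq_sym pn1.
have p'E : - (p / (p - 1))^-1 = p^-1 - 1.
  by rewrite invf_div; field; rewrite ?subr_eq0 ?pn1 gt_eqF.
(* With n = N + 1: C n^(-1/p) times D p n^(1/p) from the first n singular vectors of [B], and n D
   n^(1/p-1) C n^(-1/p) from the rest. *)
exists (C * D * p + C * D) => N u ou su; have ou' := orthonormal_list_catr ou.
have n0 : 0 < N.+1%:R :> R by rewrite ltr0n.
set n : R := N.+1%:R in n0.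
have hz (c : H -> R[i]) : let z := \sum_(y <- u) c y *: y in
    rnorm (V z) <= lambda N.+1 * rnorm z.
  apply: Vtail => x xe; rewrite dot_suml big_seq big1// => y yu.
  by rewrite dotZl (orthonormal_list_cat_perp ou yu xe) mulr0.
rewrite GE; apply: le_trans (trace_on_factor_le N.+1 bB adjB sB lV _ ou' hz) _ => //.
have pp : n `^ (- p^-1) * n `^ p^-1 = 1.
  by rewrite powRN mulVf// gt_eqF// powR_gt0.
have np : n * n `^ (p^-1 - 1) = n `^ p^-1 by rewrite mulr_powRB1// ?(ltW n0)// invr_gt0.
apply: lerD.
  apply: (@le_trans _ _ (C * n `^ (- p^-1) * (D * (p * n `^ p^-1)))).
    apply: ler_pM => //; first by rewrite sumr_ge0.
    apply: (@le_trans _ _ (D * \sum_(k < N.+1) k.+1%:R `^ (p^-1 - 1))).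
      rewrite mulr_sumr; apply: ler_sum => k _.
      by rewrite -p'E; exact: hD.
    by rewrite ler_wpM2l//; have := sum_powR_le N.+1 pinv; rewrite invrK.
  have -> : C * n `^ (- p^-1) * (D * (p * n `^ p^-1)) =
      C * D * p * (n `^ (- p^-1) * n `^ p^-1) by ring.
  by rewrite pp mulr1.
apply: (@le_trans _ _ (n * (D * n `^ (p^-1 - 1) * (C * n `^ (- p^-1))))).
  apply: ler_pM => //; first by rewrite mulr_ge0.
    by rewrite ler_nat.
  apply: ler_pM => //.
  by apply: le_trans (dnu N N.+1 (leqnSn N)) _; rewrite -p'E; exact: hD.
have -> : n * (D * n `^ (p^-1 - 1) * (C * n `^ (- p^-1))) =
    C * D * (n `^ (- p^-1) * (n * n `^ (p^-1 - 1))) by ring.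
by rewrite np pp mulr1.
Qed.

End Modulated.

Theorem theorem2p18 (R : realType) (H : completeNormedModType R[i])
    (dot : {dot H for Num.conj})
    (dot_norm : dot_induces_norm dot)
    (H_sep : separable_space H)
    (H_inf : infinite_dimensional H)
    (p : R) (p_ge1 : 1 <= p)
    (V : H -> H)
    (V_schatten : weak_schatten dot p V)
    (V_pos : strictly_positive_op dot V)
    (e : nat -> H) (lambda : nat -> R)
    (e_basis : orthonormal_basis dot e)
    (e_eigen : forall l : nat, V (e l) = (lambda l)%:C *: e l)
    (lambda_decr : nonincreasing_seq lambda)
    (G : H -> H)
    (G_schatten : weak_schatten dot 1 G)
    (G_modulated : weakly_modulated dot p V G)
    (omega : (nat -> R[i]) -> R[i])
    (omega_singular : singular_state omega) :
  dixmier_trace dot omega G =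
  omega (fun N : nat =>
    (\sum_(l < N.+1) dot (G (e l)) (e l)) / (ln N.+2%:R)%:C).
Proof.
have [V_pos0 _] := V_pos; have [cG _] := G_schatten; have [lG _] := cG.
have bG := compact_bounded cG.
have [Gad [f [adj ss]]] := singular_valuesP dot_norm e_basis cG.
have [hG mG] := weak_schatten1_approx dot_norm G_schatten adj ss.
have tr_dix := approximate_trace_is_dixmier dot_norm e_basis omega_singular.
have -> : dixmier_trace dot omega G = approximate_trace dot omega G.
  apply: (dixmier_trace_unique dot_norm e_basis _ tr_dix) => //.
  exact: (@xgetPex _ (fun=> 0) [set tr | is_dixmier_trace dot omega tr]
    (ex_intro _ _ tr_dix)).
rewrite (approximate_traceE dot_norm omega_singular lG hG mG).
have [K hK] := weakly_modulated_rest dot_norm e_basis p_ge1 V_schatten V_pos0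
  e_eigen lambda_decr G_modulated.
have [C C0 hC] := weak_schatten1_bound G_schatten.
have [[oe _] [_ _ of_ _ _]] := (e_basis, ss).
have -> : (fun N => (\sum_(l < N.+1) dot (G (e l)) (e l)) / (ln N.+2%:R)%:C) =
    trace_means dot G (fun N => mkseq e N.+1).
  by apply/funext => N; rewrite /trace_means trace_on_mkseq.
apply/esym/(proj2 (omega_eq omega_singular (K := K + C) mG _)) => N.
apply: trace_means_diff.
have [v' [u' [[ov' sv'] [ou' su'] E]]] := trace_on_extend dot_norm lG
  (orthonormal_mkseq N.+1 of_) (orthonormal_mkseq N.+1 oe).
rewrite !size_mkseq in sv' su'.
have -> : trace_on dot G (mkseq f N.+1) - trace_on dot G (mkseq e N.+1) =
    trace_on dot G u' - trace_on dot G v'.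
  by apply/eqP; rewrite subr_eq addrAC (addrC (trace_on dot G u')) -E addrK.
(* The remainder [u'], orthogonal to the eigenvectors, is bounded by modulation; [v'], orthogonal to
   the singular vectors of [G], has at most N + 1 vectors, each contributing at most C / (N + 1). *)
apply: le_trans (rnormB _ _) _; apply: lerD; first exact: hK ou' su'.
apply: le_trans (trace_on_rest dot_norm (d := C / N.+1%:R) _ ov' sv' _) _.
- by rewrite divr_ge0.
- move=> x px; apply: le_trans (singular_tail dot_norm bG adj ss px) _.
  rewrite ler_wpM2r ?rnorm_ge0//; apply: le_trans (hC _) _.
  by rewrite ler_wpM2l// lef_pV2 ?posrE ?ltr0n// ler_nat.
- by rewrite mulrC mulfVK ?pnatr_eq0.
Qed.
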